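(* Let $n\ge 1$ be an integer and $0<\alpha<\min\{2,n\}$. There exists a positive radially symmetric function $u$ on $\mathbb{R}^n$ such that $(-\Delta)^{\frac{\alpha}{2}}u\ge 0$ in $\mathbb{R}^n$, but $u(x)$ is strictly increasing with respect to $|x|$ for $|x|<1$.
   Context: For $t\in\mathbb{R}$, $[t]$ is the integer part of $t$ and $\{t\}:=t-[t]$. The fractional Laplacian $(-\Delta)^{\frac{\alpha}{2}}$ ($0<\alpha<2$) is defined pointwise, for $u\in C^{[\alpha],\{\alpha\}+\epsilon}_{loc}(\mathbb{R}^n)\cap\mathcal{L}_\alpha(\mathbb{R}^n)$ with some (arbitrarily small) $\epsilon>0$, by $$(-\Delta)^{\frac{\alpha}{2}}u(x)=C_{n,\alpha}\lim_{\varepsilon\to 0}\int_{|y-x|\ge\varepsilon}\frac{u(x)-u(y)}{|x-y|^{n+\alpha}}\,dy,$$ where $C_{n,\alpha}>0$ is the usual normalization constant and $\mathcal{L}_\alpha(\mathbb{R}^n):=\{u:\mathbb{R}^n\to\mathbb{R}\mid \int_{\mathbb{R}^n}\frac{|u(x)|}{1+|x|^{n+\alpha}}\,dx<\infty\}$. The function $u$ in the claim is understood to belong to this class, so that $(-\Delta)^{\frac{\alpha}{2}}u$ is defined pointwise. *)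

(* Defs.v *)
From HB Require Import structures.
From mathcomp Require Import all_boot all_order all_algebra.
From mathcomp Require Import all_classical all_reals all_analysis.

Set Implicit Arguments.
Unset Strict Implicit.
Unset Printing Implicit Defensive.

Import Order.TTheory GRing.Theory Num.Theory.
Import numFieldNormedType.Exports.

Local Open Scope classical_set_scope.
Local Open Scope ring_scope.

(* The norm [`|x|] of the library on ['rV[R]_n] is the sup norm, hence this
   separate Euclidean norm. *)
Definition enorm (R : realType) (n : nat) (x : 'rV[R]_n) : R :=
  Num.sqrt (\sum_(i < n) x ord0 i ^+ 2).

Definition measure_rV_display : measure_display.
Proof. exact. Qed.

Section measurable_rV.
Context {R : realType} {n : nat}.

Let coord (i : 'I_n) (x : 'rV[R]_n) : measurableTypeR R := x ord0 i.

Let rV_set0 : g_sigma_preimage coord set0.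
Proof. exact: sigma_algebra0. Qed.

Let rV_setC A : g_sigma_preimage coord A -> g_sigma_preimage coord (~` A).
Proof. exact: sigma_algebraC. Qed.

Let rV_bigcup (F : _^nat) : (forall i, g_sigma_preimage coord (F i)) ->
  g_sigma_preimage coord (\bigcup_i (F i)).
Proof. exact: sigma_algebra_bigcup. Qed.

(* The sigma-algebra generated by the coordinates, i.e. the Borel sigma-algebra
   of R^n. *)
HB.instance Definition _ := @isMeasurable.Build measure_rV_display
  'rV[R]_n (g_sigma_preimage coord) rV_set0 rV_setC rV_bigcup.

Lemma measurable_coord (i : 'I_n) :
  measurable_fun [set: 'rV[R]_n] (fun x : 'rV[R]_n => x ord0 i).
Proof.
move=> _ Y mY; rewrite setTI; apply: sub_sigma_algebra => /=.
rewrite -bigcup_seq/=; exists i => /=; first by rewrite mem_index_enum.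
by exists Y => //; rewrite setTI.
Qed.

Lemma measurable_fun_coordP d (T : measurableType d) (f : T -> 'rV[R]_n) :
  (forall i, measurable_fun [set: T] (fun t => f t ord0 i)) ->
  measurable_fun [set: T] f.
Proof.
move=> mf _ A mA.
have : preimage_set_system setT f (g_sigma_preimage coord) `<=`
    (@measurable _ T).
  rewrite -g_sigma_preimage_comp.
  apply: smallest_sub; first exact: sigma_algebra_measurable.
  rewrite -bigcup_seq/=; apply: bigcup_sub => i _ B [C mC <-].
  exact: mf.
by apply; exists A.
Qed.

End measurable_rV.

Section lebesgue_rV.
Context {R : realType}.

Definition rV_cons (n : nat) (p : measurableTypeR R * 'rV[R]_n) : 'rV[R]_n.+1 :=
  row_mx (p.1)%:M p.2 : 'rV[R]_(1 + n).

Definition rV_uncons (n : nat) (x : 'rV[R]_n.+1) :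
    measurableTypeR R * 'rV[R]_n :=
  (x ord0 ord0, \row_(i < n) x ord0 (lift ord0 i)).

Lemma rV_cons0 n p : @rV_cons n p ord0 ord0 = p.1.
Proof.
have -> : (ord0 : 'I_n.+1) = lshift n (ord0 : 'I_1) by exact/val_inj.
by apply: etrans (row_mxEl _ _ _ _) _; rewrite mxE eqxx mulr1n.
Qed.

Lemma rV_consS n p (i : 'I_n) : @rV_cons n p ord0 (lift ord0 i) = p.2 ord0 i.
Proof.
have -> : lift ord0 i = rshift 1 i :> 'I_n.+1 by exact/val_inj.
exact: row_mxEr.
Qed.

Lemma rV_consK n : cancel (@rV_cons n) (@rV_uncons n).
Proof.
move=> p; rewrite /rV_uncons rV_cons0 [RHS]surjective_pairing; congr pair.
by apply/rowP => i; rewrite mxE rV_consS.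
Qed.

Lemma measurable_rV_cons n : measurable_fun setT (@rV_cons n).
Proof.
apply: measurable_fun_coordP => i.
have [j ->|->] := unliftP ord0 i; last first.
  rewrite (_ : (fun _ => _) = fst); last by apply/funext => p; exact: rV_cons0.
  exact: measurable_fst.
rewrite (_ : (fun _ => _) = (fun x : 'rV[R]_n => x ord0 j) \o snd); last first.
  by apply/funext => p; exact: rV_consS.
by apply: measurableT_comp => //; exact: measurable_coord.
Qed.

Lemma measurable_rV_uncons n : measurable_fun setT (@rV_uncons n).
Proof.
apply/measurable_fun_pairP; split; first exact: measurable_coord.
apply: measurable_fun_coordP => i.
rewrite (_ : (fun _ => _) = fun x : 'rV[R]_n.+1 => x ord0 (lift ord0 i)).
  exact: measurable_coord.
by apply/funext => x; rewrite /= mxE.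
Qed.

Section cons_measure.
Context (n : nat) (mu : {sigma_finite_measure set 'rV[R]_n -> \bar R}).

Definition cons_measure : set 'rV[R]_n.+1 -> \bar R :=
  pushforward (@lebesgue_measure R \x mu)%E (@rV_cons n).


Let pushforward_cons : {measure set 'rV[R]_n.+1 -> \bar R}.
Proof.
refine (pushforward (@lebesgue_measure R \x mu)%E (@rV_cons n)).
exact: measurable_rV_cons.
Defined.

Let cons_measure0 : cons_measure set0 = 0%E.
Proof. exact: (measure0 pushforward_cons). Qed.

Let cons_measure_ge0 A : (0 <= cons_measure A)%E.
Proof. exact: (measure_ge0 pushforward_cons). Qed.

Let cons_measure_sigma_additive : semi_sigma_additive cons_measure.
Proof. exact: (@measure_semi_sigma_additive _ _ _ pushforward_cons). Qed.

HB.instance Definition _ := isMeasure.Build _ _ _ cons_measure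
  cons_measure0 cons_measure_ge0 cons_measure_sigma_additive.

Let cons_measure_sigma_finite : sigma_finite setT cons_measure.
Proof.
have /sigma_finiteP[F [TF ndF Foo]] := sigma_finiteT (@lebesgue_measure R).
have /sigma_finiteP[G [TG ndG Goo]] := sigma_finiteT mu.
exists (fun k => @rV_uncons n @^-1` (F k `*` G k)).
  apply/esym; rewrite -subTset => x _.
  have [k _ Fk] : (\bigcup_k F k) (rV_uncons x).1 by rewrite -TF.
  have [l _ Gl] : (\bigcup_k G k) (rV_uncons x).2 by rewrite -TG.
  exists (maxn k l) => //; split => /=.
  - by move: Fk; exact/subsetPset/ndF/leq_maxl.
  - by move: Gl; exact/subsetPset/ndG/leq_maxr.
move=> k; have [mFk Fk_oo] := Foo k; have [mGk Gk_oo] := Goo k; split.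
  rewrite -[X in measurable X]setTI; apply: measurable_rV_uncons => //.
  exact: measurableX.
rewrite /cons_measure /pushforward -comp_preimage.
rewrite (_ : _ \o _ = id) ?preimage_id; last first.
  by apply/funext => p; exact: rV_consK.
by rewrite product_measure1E// lte_mul_pinfty// ge0_fin_numE.
Qed.

HB.instance Definition _ := Measure_isSigmaFinite.Build _ _ _ cons_measure
  cons_measure_sigma_finite.

End cons_measure.

Fixpoint lebesgue_rV (n : nat) : {sigma_finite_measure set 'rV[R]_n -> \bar R} :=
  match n with
  | 0 => \d_(0 : 'rV[R]_0)
  | m.+1 => cons_measure (lebesgue_rV m)
  end.

End lebesgue_rV.

Section fractional_laplacian.
Context {R : realType}.

Definition Gamma (z : R) : R :=
  \int[@lebesgue_measure R]_(t in `]0%R, +oo[) (t `^ (z - 1) * expR (- t)).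

Context {n : nat}.
Implicit Types (u : 'rV[R]_n -> R) (x y : 'rV[R]_n) (a : R).

Local Notation basis i := (delta_mx ord0 i : 'rV[R]_n).

(* C^{k, g}_loc: all partial derivatives of order k exist and are Hoelder
   continuous of exponent g on every compact set.  When 0 < g, the partial
   derivatives of order k are continuous, so that u is of class C^k. *)
Fixpoint hoelder_loc (k : nat) (g : R) u : Prop :=
  match k with
  | 0 => forall K : set 'rV[R]_n, compact K ->
      exists M : R, forall x y, K x -> K y ->
        `|u x - u y| <= M * enorm (x - y) `^ g
  | m.+1 => forall i : 'I_n,
      (forall x, derivable u x (basis i)) /\ hoelder_loc m g ('D_(basis i) u)
  end.

Definition weighted_L1 a u : Prop :=
  measurable_fun [set: 'rV[R]_n] u /\
  (\int[@lebesgue_rV R n]_x (`|u x| / (1 + enorm x `^ (n%:R + a)))%:E < +oo)%E.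

(* C^{[a], {a} + e}_loc for some e > 0, intersected with L_a.  Since e may be
   arbitrarily small, {a} + e is kept in the range of Hoelder exponents. *)
Definition frac_laplacian_dom a u : Prop :=
  (exists e : R, [/\ 0 < e, a - (Num.truncn a)%:R + e <= 1 &
     hoelder_loc (Num.truncn a) (a - (Num.truncn a)%:R + e) u]) /\
  weighted_L1 a u.

(* The constant for which (-Delta)^(a/2) has Fourier symbol |xi|^a. *)
Definition frac_laplacian_cst a : R :=
  a * 2 `^ (a - 1) * Gamma ((n%:R + a) / 2) /
  (pi `^ (n%:R / 2) * Gamma (1 - a / 2)).

Definition frac_laplacian_trunc a u x (e : R) : R :=
  \int[@lebesgue_rV R n]_(y in [set y | e <= enorm (y - x)])
    ((u x - u y) / enorm (x - y) `^ (n%:R + a)).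

(* [lim] is total: the value is meaningful only where the truncated integrals
   converge as e tends to 0, which has to be asserted separately. *)
Definition frac_laplacian a u x : R :=
  frac_laplacian_cst a * lim (frac_laplacian_trunc a u x e @[e --> 0^'+]).

Definition radially_symmetric u : Prop :=
  forall x y, enorm x = enorm y -> u x = u y.

End fractional_laplacian.

(* Main.v *)
Require Import Defs.
From mathcomp Require Import all_boot all_order all_algebra.
From mathcomp Require Import all_classical all_reals all_analysis.
From mathcomp Require Import measurable_realfun normal_distribution.
From mathcomp Require Import ring lra.
Import Order.TTheory GRing.Theory Num.Theory.
Import numFieldNormedType.Exports.
Local Open Scope classical_set_scope.
Local Open Scope ring_scope.

(** Write w(x) = (1 + |x|^2)^(-(n-a)/2) for a = alpha.  Both the kernel |z|^(-n-a) and
    w are superpositions of Gaussians exp(-|x|^2/t) over t > 0, and the convolution of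
    two Gaussians adds their times.  In the time variable, w has density
    s^(a/2-1) e^(-1/s), and (-Delta)^(a/2) w >= 0 reduces to the elementary inequality
      int_(c < t < r) t^(-1-a/2) (r-t)^(a/2-1) dt
        <= r^(a/2-1) int_(t > c) t^(-1-a/2) dt,
    together with the monotonicity of e^(-1/s).  This uses a < n.

    Let m be the value of w on the unit sphere and
      u = 3 - max(m - w, 0)^2 - e max(w - m, 0)^2.
    On the unit ball u = 3 - e (w - m)^2 increases strictly with |x|.  Where w(x) <= m,
    u lies below its tangent in w, whose slope is nonnegative, so that
    (-Delta)^(a/2) u(x) >= 2 (m - w(x)) (-Delta)^(a/2) w(x) >= 0.  Where w(x) > m, the
    first square makes a contribution bounded below by a positive constant, since it
    vanishes at x but not far away; this dominates the second one when e is small. *)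

(** Two points shape the construction. First, [u] must be differentiable with a Lipschitz gradient:
    [alpha] may exceed 1, and a symmetric difference of size |y - x|^2 turns the principal value
    into an absolutely convergent integral, so that every inequality can be proved under the
    integral sign. Squares of positive parts achieve this, whereas a plain max would leave a kink on
    the unit sphere. They also make the two regimes meet: the slope of [u] in w vanishes at w = m,
    and inside the ball the first square is identically 0, so that its nonlocal contribution stays
    bounded below up to the sphere. The constant 3 keeps [u] positive, since both squares are at
    most 1. Second, for w itself, the integrals of w(x) and of w(y) against the singular kernel
    diverge separately. The kernel restricted to times t >= c has a finite mass, and its convolution
    with w is at most that mass times w. This is turned into a comparison between the positive and
    the negative part of 2 w(x) - w(y) - w(2x - y), each of which has a monotone limit as c tends to
    0. *)

Set Implicit Arguments.
Unset Strict Implicit.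
Unset Printing Implicit Defensive.

(** * Affine changes of variables on the real line *)

Section real_line.
Context {R : realType}.
Local Notation mu := (@lebesgue_measure R).
Implicit Types (f : R -> \bar R) (a b c : R).

(** By uniqueness of Lebesgue measure it suffices to compare both sides on half-open intervals. *)
Lemma lebesgue_measureD c (A : set R) : measurable A ->
  pushforward mu (fun x : measurableTypeR R => c + x : measurableTypeR R) A
    = mu A.
Proof.
have mc : measurable_fun setT
  (fun x : measurableTypeR R => c + x : measurableTypeR R).
  exact: measurable_funD.
pose nu : {measure set (measurableTypeR R) -> \bar R} :=
  ltac:(refine (pushforward mu
    (fun x : measurableTypeR R => c + x : measurableTypeR R)); exact: mc).
move=> mA; apply/esym.
apply: (@lebesgue_measure_unique R nu) => //= _ [[a b]] _ <-.
rewrite /nu/= /pushforward/=.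
rewrite (_ : _ @^-1` _ = `]a - c, b - c]%classic).
  rewrite !lebesgue_measure_itv/= !lte_fin ltrD2r; case: ifPn => // _.
  by rewrite -EFinB; congr EFin; ring.
by apply/seteqP; split => x /=; rewrite !in_itv/= ltrBlDl lerBrDl.
Qed.

Lemma lebesgue_measureM c (A : set R) : 0 < c -> measurable A ->
  pushforward mu (fun x : measurableTypeR R => c * x : measurableTypeR R) A
    = ((c^-1)%:E * mu A)%E.
Proof.
move=> c0.
have mc : measurable_fun setT
  (fun x : measurableTypeR R => c * x : measurableTypeR R).
  exact: measurable_funM.
pose nu : {measure set (measurableTypeR R) -> \bar R} :=
  ltac:(refine (pushforward mu
    (fun x : measurableTypeR R => c * x : measurableTypeR R)); exact: mc).
(* The factor [c] restores the length of intervals, so that uniqueness applies to [nu']. *)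
pose nu' : {measure set (measurableTypeR R) -> \bar R} := mscale (NngNum (ltW c0)) nu.
move=> mA; suff -> : mu A = nu' A.
  by rewrite /nu'/= /mscale/= muleA -EFinM mulVf ?mul1e// gt_eqF.
apply: (@lebesgue_measure_unique R nu') => //= _ [[a b]] _ <-.
rewrite /nu'/= /mscale/= /nu /= /pushforward/=.
rewrite (_ : _ @^-1` _ = `]a / c, b / c]%classic).
  rewrite !lebesgue_measure_itv/= !lte_fin ltr_pM2r ?invr_gt0//; case: ifPn => // _.
    by rewrite -EFinB -EFinM; congr EFin; field; rewrite gt_eqF.
  by rewrite mule0.
apply/seteqP; split => x /=; rewrite !in_itv/= ltr_pdivrMr ?ler_pdivlMr//;
  by rewrite ![x * _]mulrC.
Qed.

Lemma ge0_integralT_shift c f : measurable_fun setT f -> (forall x, 0 <= f x)%E ->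
  (\int[mu]_x f (c + x)%R = \int[mu]_x f x)%E.
Proof.
move=> mf f0.
have mc : measurable_fun setT
  (fun x : measurableTypeR R => c + x : measurableTypeR R).
  exact: measurable_funD.
transitivity (\int[pushforward mu
    (fun x : measurableTypeR R => (c + x)%R : measurableTypeR R)]_x f x)%E.
  by rewrite ge0_integral_pushforward//=.
by apply: eq_measure_integral => A mA _; exact: lebesgue_measureD.
Qed.

Lemma ge0_integralT_opp f : measurable_fun setT f -> (forall x, 0 <= f x)%E ->
  (\int[mu]_x f (- x)%R = \int[mu]_x f x)%E.
Proof.
move=> mf f0.
transitivity (\int[pushforward mu (-%R : _ -> measurableTypeR R)]_x f x)%E.
  by rewrite ge0_integral_pushforward.
by apply: eq_measure_integral => A mA _; exact: lebesgue_measureN.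
Qed.

Lemma ge0_integralT_scale c f : 0 < c -> measurable_fun setT f ->
  (forall x, 0 <= f x)%E ->
  (\int[mu]_x f (c * x)%R = (c^-1)%:E * \int[mu]_x f x)%E.
Proof.
move=> c0 mf f0.
have mc : measurable_fun setT
  (fun x : measurableTypeR R => c * x : measurableTypeR R).
  exact: measurable_funM.
have c0' : 0 <= c^-1 by rewrite invr_ge0 ltW.
transitivity (\int[pushforward mu
    (fun x : measurableTypeR R => (c * x)%R : measurableTypeR R)]_x f x)%E.
  by rewrite ge0_integral_pushforward//=.
rewrite -(ge0_integral_mscale _ measurableT (NngNum c0'))//.
by apply: eq_measure_integral => A mA _; exact: lebesgue_measureM.
Qed.

End real_line.

(** * Improper integrals from primitives *)

Section exhaustion.
Context d (T : measurableType d) (R : realType).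
Variable mu : {measure set T -> \bar R}.

(** Monotone convergence along [E]: a bound uniform in [k] replaces the computation of a limit. *)
Lemma ge0_integralT_exhaust_le (E : (set T)^nat) (f : T -> \bar R) (M : \bar R) :
  nondecreasing_seq E -> (forall k, measurable (E k)) ->
  measurable_fun setT f -> (forall x, (0 <= f x)%E) ->
  (forall x, ~ (\bigcup_k E k) x -> f x = 0%E) ->
  (forall k, (\int[mu]_(x in E k) f x <= M)%E) ->
  (\int[mu]_x f x <= M)%E.
Proof.
move=> ndE mE mf f0 fE leM.
have -> : (\int[mu]_x f x = \int[mu]_(x in \bigcup_k E k) f x)%E.
  rewrite [RHS]integral_mkcond; apply: eq_integral => x _.
  by rewrite patchE; case: ifPn => // /negP xE; rewrite fE// => /mem_set.
have cvgE := @ge0_nondecreasing_set_cvg_integral _ _ _ E f mu ndE mE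
  (fun i => measurable_funTS mf) (fun i x _ => f0 x).
rewrite -(cvg_lim _ cvgE)//.
by apply: lime_le; [apply/cvg_ex; eexists; exact: cvgE|exact: nearW].
Qed.

End exhaustion.

Section primitives.
Context {R : realType}.
Local Notation mu := (@lebesgue_measure R).
Implicit Types f F : R -> R.

Lemma integral_itv_primitive f F (a b : R) : a < b ->
  (forall x, a <= x <= b -> derivable f x 1) ->
  (forall x, a <= x <= b -> is_derive x 1 F (f x)) ->
  (\int[mu]_(x in `[a, b]) (f x)%:E = (F b - F a)%:E)%E.
Proof.
move=> ab df dF.
have cF x : a <= x <= b -> {for x, continuous F}.
  move=> axb; apply: differentiable_continuous; apply/derivable1_diffP.
  by have [] := dF x axb.
rewrite (continuous_FTC2 ab (F := F)) ?EFinB//.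
- apply: derivable_within_continuous => x; rewrite in_itv/= => axb.
  exact: df.
- split.
  + move=> x; rewrite in_itv/= => /andP[ax xb].
    by have [] := dF x; rewrite ?ltW.
  + apply: cvg_at_right_filter; apply: cF; by rewrite lexx ltW.
  + apply: cvg_at_left_filter; apply: cF; by rewrite lexx ltW.
- move=> x; rewrite in_itv/= => /andP[ax xb].
  rewrite derive1E; apply: derive_val.
  by apply: dF; rewrite !ltW.
Qed.

(** [f] carries cutoffs and may be singular at the ends of its support; the calculus is done on the
    smooth formula [g], which agrees with [f] on each compact piece. *)
Lemma integralT_le_primitive (a b : nat -> R) (f g F : R -> R) (M : R) :
  nonincreasing_seq a -> nondecreasing_seq b -> (forall k, a k < b k) ->
  measurable_fun setT f -> (forall x, 0 <= f x) ->
  (forall x, 0 < f x -> exists k, a k <= x <= b k) ->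
  (forall k x, a k <= x <= b k ->
    [/\ f x = g x, derivable g x 1 & is_derive x 1 F (g x)]) ->
  (forall k, F (b k) - F (a k) <= M) ->
  (\int[mu]_x (f x)%:E <= M%:E)%E.
Proof.
move=> nia ndb ab mf f0 fE gF FM.
apply: (@ge0_integralT_exhaust_le _ _ R mu
  (fun k => `[a k, b k]%classic) (EFin \o f) M%:E) => //.
- move=> i j ij; apply/subsetPset => x /=; rewrite !in_itv/= => /andP[ax xb].
  by rewrite (le_trans (nia _ _ ij))//= (le_trans xb)// ndb.
- exact/measurable_EFinP.
- move=> x xE; congr EFin; apply/eqP; rewrite eq_le f0 andbT leNgt.
  apply/negP => /fE[k axb]; apply: xE; by exists k.
- move=> k; rewrite [leLHS](_ : _ = \int[mu]_(x in `[a k, b k]) (g x)%:E)%E; last first.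
    apply: eq_integral => x; rewrite inE/= in_itv/= => axb /=.
    by have [->] := gF k x axb.
  have dg x : a k <= x <= b k -> derivable g x 1 by move=> /(gF k)[].
  have dF x : a k <= x <= b k -> is_derive x 1 F (g x) by move=> /(gF k)[].
  by rewrite (integral_itv_primitive (ab k) dg dF) lee_fin.
Qed.

End primitives.

(** * Powers of the positive part *)

Section powers.
Context {R : realType}.
Local Notation mu := (@lebesgue_measure R).
Implicit Types p q b r t : R.

(* Unlike [powR], whose value is [1] at negative reals, [ppow] vanishes for [r <= 0], so
   that integrals over the positive half-line are integrals over [R]. *)
Definition ppow p r : R := if 0 < r then r `^ p else 0.

Lemma ppow_ge0 p r : 0 <= ppow p r.
Proof. by rewrite /ppow; case: ifP => // _; exact: powR_ge0. Qed.

Lemma gt0_ppow p r : 0 < r -> ppow p r = r `^ p.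
Proof. by rewrite /ppow => ->. Qed.

Lemma ppow_le0 p r : r <= 0 -> ppow p r = 0.
Proof. by rewrite /ppow ltNge => ->. Qed.

Lemma ppow_gt0 p r : (0 < ppow p r) = (0 < r).
Proof.
by rewrite /ppow; case: ifP => r0; [rewrite powR_gt0|rewrite ltxx].
Qed.

Lemma ppowM p r c : 0 < c -> ppow p (c * r) = c `^ p * ppow p r.
Proof.
move=> c0; rewrite /ppow pmulr_rgt0//; case: ifP => r0; last by rewrite mulr0.
by rewrite powRM// ltW.
Qed.

Lemma ppowD p q r : ppow p r * ppow q r = ppow (p + q) r.
Proof.
rewrite /ppow; case: ifPn => r0; last by rewrite mul0r.
by rewrite powRD// (gt_eqF r0)/= implybT.
Qed.

Lemma measurable_ppow d (T : measurableType d) p (f : T -> R) :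
  measurable_fun setT f -> measurable_fun setT (fun x => ppow p (f x)).
Proof.
move=> mf; apply: measurable_fun_ifT.
- exact: measurable_fun_ltr.
- exact: (measurableT_comp (measurable_powR _)).
- exact: measurable_cst.
Qed.

Lemma measurable_ler_nat d (T : measurableType d) (f g : T -> R) :
  measurable_fun setT f -> measurable_fun setT g ->
  measurable_fun setT (fun x => (f x <= g x)%R%:R : R).
Proof.
move=> mf mg.
rewrite (_ : (fun _ => _) = (fun x => if f x <= g x then 1 else 0)).
  by apply: measurable_fun_ifT => //; exact: measurable_fun_ler.
by apply/funext => x; case: ifP.
Qed.

Lemma powR_succ p r : 0 < r -> r `^ p = r * r `^ (p - 1).
Proof.
move=> r0; rewrite -[X in X * _](powRr1 (ltW r0)) -powRD ?subrKC//.
by rewrite (gt_eqF r0)/= implybT.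
Qed.

Lemma is_derive_powR_div p r : p != 0 -> 0 < r ->
  is_derive r 1 (fun x : R => x `^ p / p) (r `^ (p - 1)).
Proof.
move=> p0 r0.
have := @is_derive1_powR R p r r0 => dp.
apply: is_derive_eq.
by rewrite scaler0 add0r /GRing.scale/= mulrA mulVf// mul1r.
Qed.

(** Equality is proved because this becomes the mass of the truncated kernel, which has to match
    exactly the factor [c ^ (- b) / b] of [integral_beta_le]. *)
Lemma integral_ppow_tail b c : 0 < b -> 0 < c ->
  (\int[mu]_t ((c <= t)%R%:R * ppow (- b - 1) t)%:E = (c `^ (- b) / b)%:E)%E.
Proof.
move=> b0 c0.
have bN0 : - b != 0 by rewrite oppr_eq0 gt_eqF.
pose f t := (c <= t)%R%:R * ppow (- b - 1) t.
have f0 t : 0 <= f t by rewrite /f mulr_ge0// ppow_ge0.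
have mf : measurable_fun setT f.
  by apply: measurable_funM; [exact: measurable_ler_nat|exact: measurable_ppow].
have fE x : c <= x -> f x = x `^ (- b - 1).
  by move=> cx; rewrite /f cx mul1r gt0_ppow// (lt_le_trans c0).
have dg x : c <= x -> derivable (fun t => t `^ (- b - 1)) x 1.
  by move=> cx; apply: derivable_powR; rewrite in_itv/= andbT (lt_le_trans c0).
have dF x : c <= x -> is_derive x 1 (fun t => t `^ (- b) / - b) (x `^ (- b - 1)).
  by move=> cx; apply: is_derive_powR_div => //; rewrite (lt_le_trans c0).
apply/eqP; rewrite eq_le; apply/andP; split.
  apply: (@integralT_le_primitive _ (fun=> c) (fun k => c + k.+1%:R) f
    (fun t => t `^ (- b - 1)) (fun t => t `^ (- b) / - b)) => //.
  - by move=> i j ij; rewrite lerD2l ler_nat.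
  - by move=> k; rewrite ltrDl.
  - move=> x; rewrite /f; have [cx _|] := leP c x; last by rewrite mul0r ltxx.
    exists (Num.truncn x); rewrite (le_trans (ltW (truncnS_gt _)))//.
    by rewrite lerDr ltW.
  - by move=> k x /andP[cx _]; split; [exact: fE|exact: dg|exact: dF].
  - move=> k; rewrite invrN !mulrN opprK addrC gerBl.
    by rewrite divr_ge0 ?powR_ge0// ltW.
apply/lee_addgt0Pr => e e0.
(* The tail beyond [N], namely [N ^ (- b) / b], is exactly [e]; when [N <= c] the whole right-hand
   side is at most [e]. *)
pose N := (b * e) `^ (- b^-1).
have NE : N `^ (- b) = b * e.
  rewrite /N -powRrM mulrN mulNr opprK mulVf ?gt_eqF// powRr1//.
  by rewrite mulr_ge0 ?ltW.
have N0 : 0 < N by rewrite powR_gt0// mulr_gt0.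
have [cN|Nc] := ltP c N; last first.
  apply: (@le_trans _ _ e%:E).
    rewrite lee_fin ler_pdivrMr// mulrC -NE.
    rewrite !powRN lef_pV2 ?posrE; [|exact: powR_gt0..].
    by rewrite ge0_ler_powR ?nnegrE// ltW.
  apply: leeDr => //; apply: integral_ge0 => t _; rewrite lee_fin.
  exact: f0.
apply: (@le_trans _ _ ((N `^ (- b) / - b - c `^ (- b) / - b)%:E + e%:E)).
  rewrite -EFinD lee_fin NE le_eqVlt; apply/orP; left; apply/eqP.
  by rewrite !invrN; field; rewrite gt_eqF.
have <- : (\int[mu]_(x in `[c, N]) (x `^ (- b - 1))%:E =
    (N `^ (- b) / - b - c `^ (- b) / - b)%:E)%E.
  apply: (@integral_itv_primitive _ _ (fun t => t `^ (- b) / - b)) => //.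
    by move=> x /andP[/dg].
  by move=> x /andP[/dF].
apply: leeD2r.
rewrite [leLHS](_ : _ = \int[mu]_(x in `[c, N]) (f x)%:E)%E; last first.
  by apply: eq_integral => x; rewrite inE/= in_itv/= => /andP[cx _]; rewrite fE.
apply: ge0_subset_integral => //.
  exact/measurable_EFinP.
by move=> x _; rewrite lee_fin.
Qed.

Lemma integral_ppow_head b : 0 < b < 1 ->
  (\int[mu]_t ((t <= 1)%R%:R * ppow (- b) t)%:E <= ((1 - b)^-1)%:E)%E.
Proof.
move=> /andP[b0 b1].
have bN0 : 1 - b != 0 by rewrite subr_eq0 gt_eqF.
pose f t := (t <= 1)%R%:R * ppow (- b) t.
have f0 t : 0 <= f t by rewrite /f mulr_ge0// ppow_ge0.
have mf : measurable_fun setT f.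
  by apply: measurable_funM; [exact: measurable_ler_nat|exact: measurable_ppow].
apply: (@integralT_le_primitive _ (fun k => k.+2%:R^-1) (fun=> 1) f
  (fun t => t `^ (1 - b - 1)) (fun t => t `^ (1 - b) / (1 - b))) => //.
- by move=> i j ij; rewrite lef_pV2 ?posrE// ler_nat.
- by move=> k; rewrite invf_lt1// ltr1n.
- move=> x; rewrite /f; have [x1|] := leP x 1; last by rewrite mul0r ltxx.
  rewrite mul1r ppow_gt0 => x0; exists (Num.truncn x^-1).
  rewrite andbT -[leRHS]invrK lef_pV2 ?posrE ?invr_gt0//.
  by rewrite (le_trans (ltW (truncnS_gt _)))// ler_nat.
- move=> k x /andP[kx x1].
  have x0 : 0 < x by rewrite (lt_le_trans _ kx).
  split.
  + by rewrite /f x1 mul1r gt0_ppow//; congr powR; ring.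
  + by apply: derivable_powR; rewrite in_itv/= andbT.
  + exact: is_derive_powR_div.
- move=> k; rewrite powR1 mul1r gerBl divr_ge0 ?powR_ge0//.
  by rewrite subr_ge0 ltW.
Qed.

End powers.

(** * Time integrals *)

Section time_integrals.
Context {R : realType}.
Local Notation mu := (@lebesgue_measure R).
Implicit Types p q b c r t rho : R.

(** For [c < r] the integral equals [(r - c) ^ b * c ^ (- b) / (b * r)], and [(r - c) ^ b <= r ^ b].
    The bound is the mass of [t ^ (- b - 1)] on [t >= c] times the density at [r]: a
    superharmonicity of [s ^ (b - 1)] on the time half-line, from which that of the bubble is
    derived. *)
Lemma integral_beta_le b c r : 0 < b < 1 -> 0 < c ->
  (\int[mu]_t ((c <= t)%R%:R * ppow (- b - 1) t * ppow (b - 1) (r - t))%:E <=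
   (c `^ (- b) / b * ppow (b - 1) r)%:E)%E.
Proof.
move=> /andP[b0 b1] c0.
pose f t := (c <= t)%R%:R * ppow (- b - 1) t * ppow (b - 1) (r - t).
have f0 t : 0 <= f t by rewrite /f !mulr_ge0// ppow_ge0.
have mf : measurable_fun setT f.
  apply: measurable_funM; last first.
    by apply: measurable_ppow; exact: measurable_funB.
  by apply: measurable_funM; [exact: measurable_ler_nat|exact: measurable_ppow].
have fpos x : 0 < f x -> c <= x < r.
  rewrite /f; have [cx|] := leP c x; last by rewrite !mul0r ltxx.
  have [//|rx] := ltP x r.
  by rewrite (@ppow_le0 _ (b - 1)) ?mulr0 ?ltxx// subr_le0.
have [rc|cr] := leP r c.
  rewrite (_ : \int[mu]_t _ = 0)%E; last first.
    apply: integral0_eq => x _; congr EFin; apply/eqP.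
    rewrite eq_le f0 andbT leNgt; apply/negP => /fpos/andP[cx xr].
    by have := le_lt_trans cx (lt_le_trans xr rc); rewrite ltxx.
  by rewrite lee_fin mulr_ge0 ?ppow_ge0// divr_ge0 ?powR_ge0// ltW.
have r0 := lt_trans c0 cr.
(* The integrand blows up at [r] because [b - 1 < 0], so the pieces stop short of it. *)
pose s k := r - (r - c) / k.+2%:R.
(* The primitive is [- ((r - t) / t) ^ b / (b r)]. *)
pose F t := - (b * r)^-1 * ((r - t) `^ b * t `^ (- b)).
have sr k : s k < r by rewrite /s ltrBlDr ltrDl divr_gt0// subr_gt0.
apply: (@integralT_le_primitive _ (fun=> c) s f
  (fun t => (t `^ (- b - 1) * (r - t) `^ (b - 1))) F) => //.
- move=> i j ij; rewrite /s lerD2l lerN2 ler_pM2l ?subr_gt0//.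
  by rewrite lef_pV2 ?posrE// ler_nat.
- move=> k; rewrite /s ltrBrDr -ltrBrDl.
  by rewrite ltr_pdivrMr// ltr_pMr ?subr_gt0// ltr1n.
- move=> x /fpos /andP[cx xr]; exists (Num.truncn ((r - c) / (r - x))).
  rewrite cx /= /s lerBrDr -lerBrDl ler_pdivrMr//.
  rewrite mulrC -ler_pdivrMr ?subr_gt0//.
  by rewrite (le_trans (ltW (truncnS_gt _)))// ler_nat.
- move=> k x /andP[cx xs]; have xr := le_lt_trans xs (sr k).
  have x0 := lt_le_trans c0 cx.
  have rx0 : 0 < r - x by rewrite subr_gt0.
  have dr p : is_derive x 1 (fun t => (r - t) `^ p) (- (p * (r - x) `^ (p - 1))).
    have d1 : is_derive (r - x) 1 (fun t => t `^ p) (p * (r - x) `^ (p - 1)).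
      exact: is_derive1_powR.
    have d2 : is_derive x 1 (fun t => r - t) (- 1).
      by apply: is_derive_eq; ring.
    have := @is_derive1_comp _ (fun t => t `^ p) (fun t => r - t) _ _ _ d1 d2.
    by rewrite mulrN1.
  have dx p : is_derive x 1 (fun t => t `^ p) (p * x `^ (p - 1)).
    exact: is_derive1_powR.
  split.
  + by rewrite /f cx mul1r !gt0_ppow.
  + by apply: derivableM; [have [] := dx (- b - 1)|have [] := dr (b - 1)].
  + apply: is_derive_eq.
    rewrite /GRing.scale/= (powR_succ b rx0) (powR_succ (- b) x0).
    by field; rewrite !gt_eqF.
- move=> k; apply: (@le_trans _ _ (- F c)).
    rewrite gerDr /F mulNr oppr_le0 mulr_ge0 ?invr_ge0 ?mulr_ge0 ?powR_ge0//.
      exact: ltW.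
    exact: ltW.
  rewrite /F mulNr opprK gt0_ppow//.
  apply: (@le_trans _ _ ((b * r)^-1 * (r `^ b * c `^ (- b)))).
    rewrite ler_pM2l ?invr_gt0 ?mulr_gt0//.
    rewrite ler_pM2r ?powR_gt0//.
    rewrite ge0_ler_powR ?nnegrE ?subr_ge0 ?ltW//.
    by rewrite ltrBlDr ltrDl.
  rewrite (powR_succ b r0) le_eqVlt; apply/orP; left; apply/eqP.
  by field; rewrite !gt_eqF.
Qed.

(* The integral over [r] is a multiple of [rho ^ (- q)]; here [ppow (- 1) r] stands for
   [1 / r]. *)
Definition heat q rho r : R := ppow (- q - 1) r * expR (- (rho * ppow (- 1) r)).

Lemma heat_ge0 q rho r : 0 <= heat q rho r.
Proof. by rewrite mulr_ge0 ?ppow_ge0 ?expR_ge0. Qed.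

Lemma measurable_heat d (T : measurableType d) q (f g : T -> R) :
  measurable_fun setT f -> measurable_fun setT g ->
  measurable_fun setT (fun x => heat q (f x) (g x)).
Proof.
move=> mf mg; apply: measurable_funM; first exact: measurable_ppow.
apply: measurableT_comp => //; apply: measurableT_comp => //.
by apply: measurable_funM => //; exact: measurable_ppow.
Qed.

(** The single majorant [C * (1 + r) ^ (- q - 1)] controls both ends. After taking roots of order
    [q + 1], it amounts to [1 / r <= (q + 1) / (1 + r) * exp (1 / (r (q + 1)))], which follows from
    [exp v >= 1 + v]; hence the value of [C]. *)
Lemma integral_heat_lty q : 0 < q -> (\int[mu]_r (heat q 1 r)%:E < +oo)%E.
Proof.
move=> q0.
pose C := (q + 1) `^ (q + 1).
have C0 : 0 < C by rewrite powR_gt0// addr_gt0.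
have qN0 : - q != 0 by rewrite oppr_eq0 gt_eqF.
have dF (x : R) : 0 < x -> is_derive x 1 (fun t => (1 + t) `^ (- q) / - q)
    ((1 + x) `^ (- q - 1)).
  move=> x0.
  have d1 : is_derive (1 + x) 1 (fun t => t `^ (- q) / - q)
      ((1 + x) `^ (- q - 1)).
    by apply: is_derive_powR_div => //; rewrite addr_gt0.
  have d2 : is_derive x 1 (fun t => 1 + t) (1 : R).
    by apply: is_derive_eq; ring.
  have := @is_derive1_comp _ (fun t => t `^ (- q) / - q) (fun t => 1 + t)
    _ _ _ d1 d2.
  by rewrite mulr1.
have mg : measurable_fun setT
    (fun r => (0 < r)%R%:R * (1 + r) `^ (- q - 1) : R).
  apply: measurable_funM.
    rewrite (_ : (fun _ => _) = (fun x : R => ppow 0 x)); last first.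
      by apply/funext => x; rewrite /ppow powRr0; case: ifP.
    exact: measurable_ppow.
  by apply: (measurableT_comp (measurable_powR _)); exact: measurable_funD.
apply: (@le_lt_trans _ _
    (\int[mu]_r (C * ((0 < r)%R%:R * (1 + r) `^ (- q - 1)))%:E)%E).
  apply: ge0_le_integral => //.
  - by move=> x _; rewrite lee_fin heat_ge0.
  - by apply/measurable_EFinP; apply: measurable_heat.
  - by apply/measurable_EFinP; apply: measurable_funM.
  move=> r _; rewrite lee_fin /heat.
  have [r0|r0] := ltP 0 r; last by rewrite ppow_le0// !mul0r mulr0.
  rewrite !gt0_ppow// !mul1r powR_inv1 ?(ltW r0)//.
  have -> : r `^ (- q - 1) = (r^-1) `^ (q + 1).
    rewrite -powR_inv1 ?ltW// -powRrM; congr powR; ring.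
  have -> : (1 + r) `^ (- q - 1) = ((1 + r)^-1) `^ (q + 1).
    rewrite -powR_inv1; last by rewrite addr_ge0// ltW.
    by rewrite -powRrM; congr powR; ring.
  rewrite expRN ler_pdivrMr ?expR_gt0//.
  have q1 : 0 < q + 1 by rewrite addr_gt0.
  have -> : expR r^-1 = expR (r^-1 / (q + 1)) `^ (q + 1).
    by rewrite -expRM divfK// gt_eqF.
  have r10 : 0 < 1 + r by rewrite addr_gt0.
  rewrite -!powRM ?invr_ge0 ?expR_ge0 ?(ltW r10) ?(ltW q1)//; last first.
    by rewrite mulr_ge0 ?invr_ge0 ?ltW.
  rewrite ge0_ler_powR ?(ltW q1)// ?nnegrE ?invr_ge0 ?(ltW r0)//.
    by rewrite !mulr_ge0 ?expR_ge0 ?invr_ge0 ?ltW.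
  apply: (@le_trans _ _ ((q + 1) * (1 + r)^-1 * (1 + r^-1 / (q + 1)))).
    rewrite -subr_ge0.
    rewrite (_ : _ - _ = q * (1 + r)^-1); last by field; rewrite !gt_eqF.
    by rewrite mulr_ge0 ?invr_ge0 ?ltW.
  by rewrite ler_pM2l ?expR_ge1Dx// mulr_gt0 ?invr_gt0.
under eq_integral do rewrite EFinM.
rewrite ge0_integralZl_EFin//; first last.
- exact: ltW.
- apply/measurable_EFinP; exact: mg.
- by move=> x _; rewrite lee_fin mulr_ge0 ?powR_ge0.
apply: lte_mul_pinfty => //; first by rewrite lee_fin ltW.
apply: (@le_lt_trans _ _ (q^-1)%:E); last exact: ltry.
apply: (@integralT_le_primitive _ (fun k => k.+1%:R^-1) (fun k => k.+2%:R)
  _ (fun t => (1 + t) `^ (- q - 1)) (fun t => (1 + t) `^ (- q) / - q)) => //.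
- by move=> i j ij; rewrite lef_pV2 ?posrE// ler_nat.
- by move=> i j ij; rewrite ler_nat.
- move=> k; apply: (@le_lt_trans _ _ 1); last by rewrite ltr1n.
  by rewrite invf_le1// ler1n.
- by move=> x; rewrite mulr_ge0 ?powR_ge0.
- move=> x; have [x0 _|] := ltP 0 x; last by rewrite mul0r ltxx.
  exists (Num.truncn (x + x^-1)); apply/andP; split.
    rewrite -[leRHS]invrK lef_pV2 ?posrE ?invr_gt0//.
    rewrite (le_trans _ (ltW (truncnS_gt _)))// lerDr.
    exact: ltW.
  rewrite (@le_trans _ _ (Num.truncn (x + x^-1)).+1%:R)// ?ler_nat//.
  rewrite (le_trans _ (ltW (truncnS_gt _)))// lerDl invr_ge0.
  exact: ltW.
- move=> k x /andP[kx _].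
  have x0 : 0 < x by rewrite (lt_le_trans _ kx).
  split.
  + by rewrite x0 mul1r.
  + have d1 : is_derive (1 + x) 1 (fun t => t `^ (- q - 1))
        ((- q - 1) * (1 + x) `^ (- q - 1 - 1)).
      by apply: is_derive1_powR; rewrite addr_gt0.
    have d2 : is_derive x 1 (fun t => 1 + t) (1 : R).
      by apply: is_derive_eq; ring.
    by have [] := @is_derive1_comp _ (fun t => t `^ (- q - 1)) (fun t => 1 + t)
      _ _ _ d1 d2.
  + exact: dF.
- move=> k; rewrite invrN !mulrN opprK addrC.
  apply: (@le_trans _ _ ((1 + k.+1%:R^-1) `^ (- q) / q)).
    by rewrite gerBl divr_ge0 ?powR_ge0// ltW.
  rewrite ler_pdivrMr// mulVf ?gt_eqF// powRN invf_le1 ?powR_gt0//.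
  have h : 1 <= 1 + k.+1%:R^-1 :> R by rewrite lerDl.
  apply: (@le_trans _ _ (1 `^ q)); first by rewrite powR1.
  by apply: ge0_ler_powR => //; rewrite ?nnegrE ?ltW.
Qed.

Lemma integral_heat_gt0 q : 0 < q -> (0 < \int[mu]_r (heat q 1 r)%:E)%E.
Proof.
(* On [[1, 2]] the power is at least its value at 2 and the exponential at least its value at 1. *)
move=> q0; pose c := 2 `^ (- q - 1) * expR (-1) : R.
have c0 : 0 < c by rewrite mulr_gt0 ?powR_gt0 ?expR_gt0.
have h1 : (0 < \int[mu]_(r in `[1%R, 2%R]) c%:E)%E.
  rewrite integral_cst//= lebesgue_measure_itv/= lte_fin ltr1n.
  by rewrite -EFinB -EFinM lte_fin mulr_gt0// subr_gt0 ltr1n.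
apply: lt_le_trans h1 _.
apply: (@le_trans _ _ (\int[mu]_(r in `[1%R, 2%R]) (heat q 1 r)%:E)%E).
  apply: ge0_le_integral => //.
  - by move=> x _; rewrite lee_fin ltW.
  - by apply/measurable_EFinP/measurable_funTS; exact: measurable_heat.
  move=> x; rewrite /= in_itv/= => /andP[x1 x2]; rewrite lee_fin /heat.
  have x0 : 0 < x by rewrite (lt_le_trans _ x1).
  rewrite !gt0_ppow// mul1r powR_inv1 ?(ltW x0)// ler_pM ?powR_ge0 ?expR_ge0//.
    have -> : - q - 1 = - (q + 1) by ring.
    rewrite !powRN lef_pV2 ?posrE ?powR_gt0//.
    by rewrite ge0_ler_powR ?nnegrE ?addr_ge0// ?ltW.
  by rewrite ler_expR lerN2 invf_le1.
apply: ge0_subset_integral => //.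
  by apply/measurable_EFinP; exact: measurable_heat.
by move=> x _; rewrite lee_fin heat_ge0.
Qed.

(** Substitution of [rho * r] for [r]: the two sides of the change of variables differ by one factor
    [rho], cleared at the end. *)
Lemma integral_heat_scale q rho : 0 < rho ->
  (\int[mu]_r (heat q rho r)%:E =
   (rho `^ (- q))%:E * \int[mu]_r (heat q 1 r)%:E)%E.
Proof.
move=> rho0.
have mh : measurable_fun setT (fun r => (heat q rho r)%:E).
  by apply/measurable_EFinP; exact: measurable_heat.
have h0 r : (0 <= (heat q rho r)%:E)%E by rewrite lee_fin heat_ge0.
have E1 := ge0_integralT_scale rho0 mh h0.
have E2 : (\int[mu]_r (heat q rho (rho * r))%:E =
    (rho `^ (- q - 1))%:E * \int[mu]_r (heat q 1 r)%:E)%E.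
  rewrite -ge0_integralZl_EFin ?powR_ge0//; last 2 first.
    by move=> x _; rewrite lee_fin heat_ge0.
    by apply/measurable_EFinP; exact: measurable_heat.
  apply: eq_integral => x _; rewrite -EFinM; congr EFin.
  rewrite /heat (ppowM _ _ rho0) -mulrA; congr (_ * (_ * _)).
  congr (expR (- _)).
  have [x0|x0] := ltP 0 x; last first.
    by rewrite !ppow_le0 ?mulr0// pmulr_rle0.
  rewrite mul1r !gt0_ppow ?mulr_gt0// !powR_inv1 ?(ltW x0)//; last first.
    by rewrite mulr_ge0 ?ltW.
  by rewrite invfM mulrA divff ?mul1r// gt_eqF.
move: (etrans (esym E2) E1) => {E1 E2}.
move: (\int[mu]_r (heat q 1 r)%:E)%E (\int[mu]_r (heat q rho r)%:E)%E => I J.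
move=> /(congr1 (fun z => rho%:E * z)%E).
rewrite !muleA -!EFinM divff ?gt_eqF// mul1e => <-.
by rewrite -powR_succ.
Qed.

End time_integrals.

(** * Lebesgue measure on row vectors *)

Section euclidean_space.
Context {R : realType}.
Local Notation mu := (@lebesgue_measure R).

Definition esq n (x : 'rV[R]_n) : R := \sum_(i < n) x ord0 i ^+ 2.

Lemma esq_ge0 n (x : 'rV[R]_n) : 0 <= esq x.
Proof. by apply: sumr_ge0 => i _; exact: sqr_ge0. Qed.

Lemma esq_cons n (p : measurableTypeR R * 'rV[R]_n) :
  esq (rV_cons p) = p.1 ^+ 2 + esq p.2.
Proof.
rewrite /esq big_ord_recl rV_cons0; congr (_ + _).
by apply: eq_bigr => i _; rewrite rV_consS.
Qed.

Lemma rVBE n (x y : 'rV[R]_n) i : (x - y) ord0 i = x ord0 i - y ord0 i.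
Proof. by rewrite !mxE. Qed.

Lemma rV_consB n (p q : measurableTypeR R * 'rV[R]_n) :
  rV_cons p - rV_cons q = rV_cons (p.1 - q.1 : R, p.2 - q.2).
Proof.
apply/rowP => i; have [j ->|->] := unliftP ord0 i.
  by rewrite rVBE !rV_consS rVBE.
by rewrite rVBE !rV_cons0.
Qed.

Lemma rV_unconsK n (x : 'rV[R]_n.+1) : rV_cons (rV_uncons x) = x.
Proof.
apply/rowP => i; have [j ->|->] := unliftP ord0 i.
  by rewrite rV_consS mxE.
by rewrite rV_cons0.
Qed.

Lemma measurable_rVB d (T : measurableType d) n (f g : T -> 'rV[R]_n) :
  measurable_fun setT f -> measurable_fun setT g ->
  measurable_fun setT (fun x => f x - g x).
Proof.
move=> mf mg; apply: measurable_fun_coordP => i.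
rewrite (_ : (fun _ => _) = (fun t => f t ord0 i - g t ord0 i)); last first.
  by apply/funext => t; rewrite rVBE.
apply: measurable_funB.
  by apply: (measurableT_comp (measurable_coord i)).
by apply: (measurableT_comp (measurable_coord i)).
Qed.

Lemma measurable_esq d (T : measurableType d) n (f : T -> 'rV[R]_n) :
  measurable_fun setT f -> measurable_fun setT (fun x => esq (f x)).
Proof.
move=> mf; apply: measurable_sum => i; apply: measurable_funX.
by apply: (measurableT_comp (measurable_coord i)).
Qed.

Lemma integral_rV0 (f : 'rV[R]_0 -> \bar R) : measurable_fun setT f ->
  (\int[@lebesgue_rV R 0]_x f x = f 0%R)%E.
Proof. by move=> mf; rewrite /= integral_dirac// diracT mul1e. Qed.

Lemma ge0_integral_rVS n (f : 'rV[R]_n.+1 -> \bar R) :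
  measurable_fun setT f -> (forall x, 0 <= f x)%E ->
  (\int[@lebesgue_rV R n.+1]_x f x =
   \int[mu]_t \int[@lebesgue_rV R n]_y f (rV_cons (t, y)))%E.
Proof.
move=> mf f0.
transitivity (\int[pushforward (mu \x @lebesgue_rV R n)%E
    (@rV_cons R n)]_x f x)%E; first by [].
rewrite ge0_integral_pushforward//=; last exact: measurable_rV_cons.
rewrite fubini_tonelli1//=.
by apply: measurableT_comp => //; exact: measurable_rV_cons.
Qed.

(** Induction on the dimension; in the first coordinate the map is a sign change followed by a
    translation of the line. With [c = x + x] this is the reflection in [x] that symmetrizes the
    singular integral. *)
Lemma ge0_integral_rV_reflect n (c : 'rV[R]_n) (f : 'rV[R]_n -> \bar R) :
  measurable_fun setT f -> (forall x, 0 <= f x)%E ->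
  (\int[@lebesgue_rV R n]_x f (c - x)%R = \int[@lebesgue_rV R n]_x f x)%E.
Proof.
elim: n => [|n IHn] in c f * => mf f0.
  by apply: eq_integral => x _; congr f; rewrite [LHS]thinmx0 [RHS]thinmx0.
have mB m (e : 'rV[R]_m) : measurable_fun setT (fun x : 'rV[R]_m => e - x).
  exact: measurable_rVB.
have mfr : measurable_fun setT (fun x : 'rV[R]_n.+1 => f (c - x)).
  by apply: (measurableT_comp mf); exact: mB.
apply: (etrans (ge0_integral_rVS mfr (fun x => f0 (c - x)))).
apply: (etrans _ (esym (ge0_integral_rVS mf f0))).
have mfc : measurable_fun setT (f \o @rV_cons R n).
  by apply: (measurableT_comp mf); exact: measurable_rV_cons.
pose G (t : R) := (\int[@lebesgue_rV R n]_y f (rV_cons (t, y)))%E.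
have mG : measurable_fun setT G.
  apply: (@measurable_fun_fubini_tonelli_F _ _ _ _ R (@lebesgue_rV R n)
    (f \o @rV_cons R n)) => //.
  by move=> ?; exact: f0.
have G0 t : (0 <= G t)%E by apply: integral_ge0.
rewrite -(rV_unconsK c); set c1 := (rV_uncons c).1; set c2 := (rV_uncons c).2.
transitivity (\int[mu]_t G (c1 - t)%R)%E.
  apply: eq_integral => t _; rewrite /G.
  rewrite -[RHS](IHn c2)//; last first.
    by apply: (measurable_fun_pair2 (c1 - t : measurableTypeR R) mfc).
  by apply: eq_integral => y _; rewrite rV_consB.
rewrite -[RHS]/(\int[mu]_t G t)%E.
move: G mG G0 => G mG G0.
have mGc : measurable_fun setT (fun t => G (c1 + t)%R).
  by apply: (measurableT_comp mG); exact: measurable_funD.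
apply: (etrans (ge0_integralT_opp mGc (fun t => G0 (c1 + t)%R))).
exact: (ge0_integralT_shift c1 mG G0).
Qed.

Lemma integralT_gauss_shift (A B s : R) : 0 <= A -> 0 <= B -> 0 < A + B ->
  (\int[mu]_t (expR (- (A * (t - s) ^+ 2 + B * t ^+ 2)))%:E =
   (Num.sqrt (pi / (A + B)) * expR (- (A * B / (A + B) * s ^+ 2)))%:E)%E.
Proof.
move=> A0 B0 AB0.
(* Completing the square, the exponent is [- ((A + B) (t - m)^2 + A B / (A + B) s^2)], so the
   integrand is [k] times the normal density of mean [m] and variance [sg ^ 2]. *)
pose sg := Num.sqrt ((2 * (A + B))^-1).
have sg2 : sg ^+ 2 = (2 * (A + B))^-1.
  by rewrite /sg sqr_sqrtr// invr_ge0 ltW// mulr_gt0.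
have sg0 : sg != 0 by rewrite gt_eqF// sqrtr_gt0 invr_gt0 mulr_gt0.
pose m := A * s / (A + B).
pose k := Num.sqrt (pi / (A + B)) * expR (- (A * B / (A + B) * s ^+ 2)).
have k0 : 0 <= k by rewrite mulr_ge0 ?sqrtr_ge0 ?expR_ge0.
transitivity (\int[mu]_t (k%:E * (normal_pdf m sg t)%:E))%E.
  apply: eq_integral => t _; rewrite -EFinM; congr EFin.
  rewrite normal_pdfE// /normal_peak /normal_fun.
  have -> : sg ^+ 2 * pi *+ 2 = pi / (A + B).
    by rewrite sg2 -mulr_natr; field; rewrite gt_eqF.
  have spi : Num.sqrt (pi / (A + B)) != 0.
    by rewrite gt_eqF// sqrtr_gt0 divr_gt0// pi_gt0.
  rewrite /k mulrACA divff// mul1r -expRD; congr expR.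
  rewrite sg2 /m -mulr_natr; field.
  by rewrite gt_eqF.
rewrite ge0_integralZl_EFin//; last 2 first.
  by move=> x _; rewrite lee_fin normal_pdf_ge0.
  by apply/measurable_EFinP; exact: measurable_normal_pdf.
by rewrite integral_normal_pdf mule1.
Qed.

Lemma measurable_rV_gauss n (A B : R) (x : 'rV[R]_n) :
  measurable_fun setT
    (fun y : 'rV[R]_n => (expR (- (A * esq (y - x) + B * esq y)))%:E).
Proof.
apply/measurable_EFinP; apply: measurableT_comp => //; apply: measurableT_comp => //.
apply: measurable_funD; apply: measurable_funM => //; apply: measurable_esq => //.
exact: measurable_rVB.
Qed.

(** The exponent is a sum over coordinates, so the integral factors. The case [B = 0] is included
    because it gives the mass of a single Gaussian. *)
Lemma integral_rV_gauss n (A B : R) (x : 'rV[R]_n) :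
  0 <= A -> 0 <= B -> 0 < A + B ->
  (\int[@lebesgue_rV R n]_y (expR (- (A * esq (y - x) + B * esq y)))%:E =
   (Num.sqrt (pi / (A + B)) ^+ n * expR (- (A * B / (A + B) * esq x)))%:E)%E.
Proof.
move=> A0 B0 AB0; elim: n => [|n IHn] in x *.
  rewrite integral_rV0; last exact: measurable_rV_gauss.
  by rewrite /esq !big_ord0 !mulr0 addr0 oppr0 expR0 mulr1.
rewrite ge0_integral_rVS; first last.
  - by move=> y; rewrite lee_fin expR_ge0.
  - exact: measurable_rV_gauss.
rewrite -(rV_unconsK x); case: (rV_uncons x) => x1 x2.
pose C := Num.sqrt (pi / (A + B)) ^+ n * expR (- (A * B / (A + B) * esq x2)).
have C0 : 0 <= C by rewrite mulr_ge0 ?exprn_ge0 ?sqrtr_ge0 ?expR_ge0.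
transitivity (\int[mu]_t
    (C%:E * (expR (- (A * (t - x1) ^+ 2 + B * t ^+ 2)))%:E))%E.
  apply: eq_integral => t _.
  rewrite /C -IHn muleC -ge0_integralZl_EFin ?expR_ge0//; last first.
    exact: measurable_rV_gauss.
  apply: eq_integral => y _; rewrite -EFinM -expRD; congr (expR _)%:E.
  by rewrite rV_consB !esq_cons/=; ring.
rewrite ge0_integralZl_EFin//; last first.
  apply/measurable_EFinP; apply: measurableT_comp => //.
  apply: measurableT_comp => //.
  apply: measurable_funD; apply: measurable_funM => //.
  by apply: measurable_funX; exact: measurable_funB.
rewrite integralT_gauss_shift// -EFinM; congr EFin.
rewrite /C esq_cons/= (exprSr (Num.sqrt _)) mulrACA -expRD; congr (_ * expR _).
by rewrite mulrDr opprD addrC.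
Qed.

End euclidean_space.

(** * Subordination *)

Section heat_constant.
Context {R : realType}.
Local Notation mu := (@lebesgue_measure R).
Implicit Types q rho : R.

Definition heat_cst q : R := fine (\int[mu]_r (heat q 1 r)%:E)%E.

Lemma heat_cst_fin q : 0 < q ->
  (\int[mu]_r (heat q 1 r)%:E = (heat_cst q)%:E)%E.
Proof.
move=> q0; rewrite fineK// ge0_fin_numE ?integral_heat_lty//.
by apply: integral_ge0 => r _; rewrite lee_fin heat_ge0.
Qed.

Lemma heat_cst_gt0 q : 0 < q -> 0 < heat_cst q.
Proof.
by move=> q0; have := integral_heat_gt0 q0; rewrite heat_cst_fin.
Qed.

Lemma integral_heat q rho : 0 < q -> 0 < rho ->
  (\int[mu]_r (heat q rho r)%:E = (heat_cst q * rho `^ (- q))%:E)%E.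
Proof.
move=> q0 rho0.
by rewrite integral_heat_scale// heat_cst_fin// -EFinM mulrC.
Qed.

Lemma gt0_powRD (x r s : R) : 0 < x -> x `^ (r + s) = x `^ r * x `^ s.
Proof. by move=> x0; rewrite powRD// (gt_eqF x0)/= implybT. Qed.

Lemma sqrt_expr_powR (x : R) n : 0 <= x ->
  Num.sqrt x ^+ n = x `^ (n%:R / 2).
Proof.
move=> x0; rewrite -powR12_sqrt// -powR_mulrn ?powR_ge0// -powRrM.
by congr powR; rewrite mulrC.
Qed.

End heat_constant.

Section tonelli.
Context d1 d2 (T1 : measurableType d1) (T2 : measurableType d2) (R : realType).
Variables (m1 : {sigma_finite_measure set T1 -> \bar R})
  (m2 : {sigma_finite_measure set T2 -> \bar R}).

Lemma tonelli_EFin (f : T1 -> T2 -> R) :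
  measurable_fun setT (fun p : T1 * T2 => f p.1 p.2) ->
  (forall x y, 0 <= f x y) ->
  (\int[m1]_x \int[m2]_y (f x y)%:E = \int[m2]_y \int[m1]_x (f x y)%:E)%E.
Proof.
move=> mf f0.
apply: (fubini_tonelli (m1 := m1) (m2 := m2)
  (fun p : T1 * T2 => (f p.1 p.2)%:E)).
  exact/measurable_EFinP.
by move=> p; rewrite lee_fin.
Qed.

Lemma measurable_fun_flip d3 (T3 : measurableType d3) (f : T1 -> T2 -> T3) :
  measurable_fun setT (fun p : T1 * T2 => f p.1 p.2) ->
  measurable_fun setT (fun p : T2 * T1 => f p.2 p.1).
Proof.
by move=> mf; exact: (measurableT_comp mf (@measurable_swap _ _ T2 T1)).
Qed.

Lemma measurable_integral_EFin (f : T1 -> T2 -> R) :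
  measurable_fun setT (fun p : T1 * T2 => f p.1 p.2) ->
  (forall x y, 0 <= f x y) ->
  measurable_fun setT (fun x => \int[m2]_y (f x y)%:E)%E.
Proof.
move=> mf f0.
apply: (@measurable_fun_fubini_tonelli_F _ _ _ _ R m2
  (fun p : T1 * T2 => (f p.1 p.2)%:E)).
  exact/measurable_EFinP.
by move=> p; rewrite lee_fin.
Qed.

End tonelli.

Section subordination.
Context {R : realType} (n : nat) (a : R).
Hypotheses (a0 : 0 < a) (a2 : a < 2) (an : a < n%:R).
Local Notation mu := (@lebesgue_measure R).
Local Notation leb := (@lebesgue_rV R n).
Local Notation rV := 'rV[R]_n.
Implicit Types (x y z : rV) (s t r c : R).

Local Notation b := (a / 2).
Local Notation Q := ((n%:R + a) / 2).
Local Notation q := ((n%:R - a) / 2).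
Local Notation S := (Num.sqrt pi ^+ n).

Let b01 : 0 < b < 1.
Proof. by rewrite divr_gt0//= ltr_pdivrMr// mul1r. Qed.

Let Q0 : 0 < Q. Proof. by rewrite divr_gt0// addr_gt0// (lt_trans a0). Qed.

Let q0 : 0 < q. Proof. by rewrite divr_gt0// subr_gt0. Qed.

Let S0 : 0 < S :> R. Proof. by rewrite exprn_gt0// sqrtr_gt0 pi_gt0. Qed.

Lemma integral_gauss_time t x : 0 < t ->
  (\int[leb]_y (expR (- (t^-1 * esq (y - x))))%:E =
   (S * t `^ (n%:R / 2))%:E)%E.
Proof.
move=> t0.
have := @integral_rV_gauss R n t^-1 0 x; rewrite invr_ge0 addr0 invr_gt0.
move=> /(_ (ltW t0) (lexx _) t0); rewrite mulr0 !mul0r oppr0 expR0 mulr1 invrK.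
move=> h; rewrite sqrtrM ?pi_ge0// exprMn (sqrt_expr_powR n (ltW t0)) in h.
rewrite -h; apply: eq_integral => y _.
by rewrite mul0r addr0.
Qed.

(** The Gaussian factors combine through [1 / (1/t + 1/s) = t s / (t + s)], and the exponents become
    [- Q - 1 + n/2 = - b - 1] and [- q - 1 + n/2 = b - 1]. The only loss is
    [exp (- 1/s) <= exp (- 1/(t + s))], which leaves an expression in [x] that depends on the times
    through their sum alone. *)
Lemma integral_heat_heat_le t s x :
  (\int[leb]_y (heat Q (esq (y - x)) t * heat q (1 + esq y) s)%:E <=
   (S * (ppow (- b - 1) t * ppow (b - 1) s *
     (ppow (- (n%:R / 2)) (t + s) *
      expR (- ((1 + esq x) * ppow (- 1) (t + s))))))%:E)%E.
Proof.
have [t0|t0] := ltP 0 t; last first.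
  rewrite (ppow_le0 _ t0) !mul0r mulr0 integral0_eq// => y _.
  by rewrite /heat (ppow_le0 _ t0) !mul0r.
have [s0|s0] := ltP 0 s; last first.
  rewrite (ppow_le0 (b - 1) s0) mulr0 !mul0r mulr0 integral0_eq// => y _.
  by rewrite /heat (ppow_le0 (- q - 1) s0) !mul0r mulr0.
have ts0 : 0 < t + s by rewrite addr_gt0.
pose C := t `^ (- Q - 1) * s `^ (- q - 1) * expR (- s^-1).
have C0 : 0 <= C by rewrite !mulr_ge0 ?powR_ge0 ?expR_ge0.
have -> : (\int[leb]_y (heat Q (esq (y - x)) t * heat q (1 + esq y) s)%:E =
    \int[leb]_y (C%:E * (expR (- (t^-1 * esq (y - x) + s^-1 * esq y)))%:E))%E.
  apply: eq_integral => y _; rewrite -EFinM; congr EFin.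
  rewrite /heat /C !gt0_ppow// !powR_inv1 ?ltW//.
  rewrite (_ : expR (- ((1 + esq y) / s)) = expR (- s^-1) * expR (- (s^-1 * esq y))).
    rewrite opprD expRD [esq _ / t]mulrC; ring.
  by rewrite -expRD; congr expR; ring.
have ts1 : 0 < t^-1 + s^-1 by rewrite addr_gt0 ?invr_gt0.
rewrite ge0_integralZl_EFin//; last exact: measurable_rV_gauss.
rewrite integral_rV_gauss ?invr_ge0 ?(ltW t0) ?(ltW s0)// -EFinM lee_fin.
have -> : pi / (t^-1 + s^-1) = pi * (t * s * (t + s)^-1).
  by field; rewrite !gt_eqF// addrC.
have -> : t^-1 / s / (t^-1 + s^-1) * esq x = esq x / (t + s).
  by field; rewrite !gt_eqF// addrC.
rewrite sqrtrM ?pi_ge0// exprMn (@sqrt_expr_powR _ (t * s * (t + s)^-1)); last first.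
  by rewrite !mulr_ge0 ?invr_ge0// ltW.
rewrite !powRM ?mulr_ge0 ?invr_ge0 ?(ltW t0) ?(ltW s0) ?(ltW ts0)//.
rewrite !gt0_ppow// powR_inv1 ?(ltW ts0)//.
rewrite -[(t + s)^-1]powR_inv1 ?(ltW ts0)// -powRrM mulN1r.
rewrite /C.
have -> : t `^ (- b - 1) = t `^ (- Q - 1) * t `^ (n%:R / 2).
  by rewrite -gt0_powRD//; congr powR; field.
have -> : s `^ (b - 1) = s `^ (- q - 1) * s `^ (n%:R / 2).
  by rewrite -gt0_powRD//; congr powR; field.
(* [D] collects the powers common to both sides, so that only exponentials remain to be compared. *)
pose D := S * (t `^ (- Q - 1) * t `^ (n%:R / 2) * (s `^ (- q - 1) * s `^ (n%:R / 2)) *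
  (t + s) `^ (- (n%:R / 2))).
apply: (@le_trans _ _ (D * (expR (- s^-1) * expR (- (esq x / (t + s)))))).
  by rewrite le_eqVlt; apply/orP; left; apply/eqP; rewrite /D powR_inv1 ?(ltW ts0)//; ring.
rewrite [leRHS](_ : _ = D * expR (- ((1 + esq x) / (t + s)))); last first.
  by rewrite /D powR_inv1 ?(ltW ts0)//; ring.
rewrite ler_wpM2l//; first by rewrite /D !mulr_ge0 ?powR_ge0// ltW.
rewrite -expRD ler_expR mulrDl mul1r opprD lerD2r lerN2.
by rewrite lef_pV2 ?posrE// lerDr ltW.
Qed.

(* Cutting off the times below [c] makes the kernel integrable, so that no cancellation
   is needed in Tonelli's theorem. *)
Definition theat c t z : R := (c <= t)%R%:R * heat Q (esq z) t.

Lemma theat_ge0 c t z : 0 <= theat c t z.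
Proof. by rewrite mulr_ge0 ?heat_ge0. Qed.

Lemma measurable_theat d (T : measurableType d) c (f : T -> R) (g : T -> rV) :
  measurable_fun setT f -> measurable_fun setT g ->
  measurable_fun setT (fun p => theat c (f p) (g p)).
Proof.
move=> mf mg; apply: measurable_funM; first exact: measurable_ler_nat.
by apply: measurable_heat => //; exact: measurable_esq.
Qed.

Let mcenter x : measurable_fun setT (fun y : rV => y - x).
Proof. exact: measurable_rVB. Qed.

(** At each time the Gaussian mass raises the exponent [- Q - 1] to [- b - 1], whose tail is
    explicit. The result blows up as [c] tends to 0, so it has to be cancelled before the limit. *)
Lemma integral_theat_mass c x : 0 < c ->
  (\int[leb]_y \int[mu]_t (theat c t (y - x))%:E =
   (S * (c `^ (- b) / b))%:E)%E.
Proof.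
move=> c0.
rewrite (tonelli_EFin leb mu (f := fun y t => theat c t (y - x))).
- transitivity (\int[mu]_t (S%:E * ((c <= t)%R%:R * ppow (- b - 1) t)%:E))%E.
    apply: eq_integral => t _.
    have [t0|t0] := ltP 0 t; last first.
      rewrite (ppow_le0 _ t0) mulr0 mule0 integral0_eq// => y _.
      by rewrite /theat /heat (ppow_le0 _ t0) mul0r mulr0.
    transitivity (\int[leb]_y (((c <= t)%R%:R * t `^ (- Q - 1))%:E *
        (expR (- (t^-1 * esq (y - x))))%:E))%E.
      apply: eq_integral => y _; rewrite -EFinM /theat /heat !gt0_ppow//.
      by rewrite powR_inv1 ?(ltW t0)// -mulrA [esq _ / t]mulrC.
    rewrite ge0_integralZl_EFin ?mulr_ge0 ?powR_ge0//; last first.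
      apply/measurable_EFinP; apply: measurableT_comp => //.
      apply: measurableT_comp => //; apply: measurable_funM => //.
      exact: measurable_esq.
    rewrite integral_gauss_time// -!EFinM; congr EFin.
    rewrite gt0_ppow//.
    have -> : t `^ (- b - 1) = t `^ (- Q - 1) * t `^ (n%:R / 2).
      by rewrite -gt0_powRD//; congr powR; field.
    ring.
  rewrite ge0_integralZl_EFin ?(ltW S0)//; last 2 first.
  + by move=> t _; rewrite lee_fin mulr_ge0 ?ppow_ge0.
  + apply/measurable_EFinP; apply: measurable_funM.
      exact: measurable_ler_nat.
    exact: measurable_ppow.
  by rewrite integral_ppow_tail// divr_gt0.
- by apply: measurable_theat => //; exact: (measurableT_comp (mcenter x)).
- by move=> y t; exact: theat_ge0.
Qed.

Definition bubble y : R := (1 + esq y) `^ (- q).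

Lemma measurable_bubble : measurable_fun setT bubble.
Proof.
apply: (measurableT_comp (measurable_powR _)); apply: measurable_funD => //.
exact: measurable_esq.
Qed.

Lemma bubble_ge0 y : 0 <= bubble y. Proof. exact: powR_ge0. Qed.

Lemma bubble_heat y :
  (\int[mu]_s (heat q (1 + esq y) s)%:E = (heat_cst q * bubble y)%:E)%E.
Proof.
apply: integral_heat => //.
by rewrite (lt_le_trans ltr01)// lerDl esq_ge0.
Qed.

(** With the kernel time [t] fixed, the bubble is expanded in its own time [s], and the total time
    [r = t + s] becomes the variable of integration. *)
Lemma integral_theat_bubble_time c t x :
  ((heat_cst q)%:E * \int[leb]_y (theat c t (y - x) * bubble y)%:E <=
   \int[mu]_r (S * (ppow (- (n%:R / 2)) r * expR (- ((1 + esq x) * ppow (- 1) r)) *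
     ((c <= t)%R%:R * ppow (- b - 1) t * ppow (b - 1) (r - t))))%:E)%E.
Proof.
pose f y s := theat c t (y - x) * heat q (1 + esq y) s.
pose B s : R := (c <= t)%R%:R * (S * (ppow (- b - 1) t * ppow (b - 1) s *
     (ppow (- (n%:R / 2)) (t + s) *
      expR (- ((1 + esq x) * ppow (- 1) (t + s)))))).
have mB : measurable_fun setT B.
  apply: measurable_funM => //; apply: measurable_funM => //.
  apply: measurable_funM.
    by apply: measurable_funM => //; exact: measurable_ppow.
  have mts : measurable_fun setT (fun s : R => t + s) by exact: measurable_funD.
  apply: measurable_funM; first exact: measurable_ppow.
  apply: measurableT_comp => //; apply: measurableT_comp => //.
  by apply: measurable_funM => //; exact: measurable_ppow.
have B0 s : 0 <= B s.
  by rewrite !mulr_ge0 ?ppow_ge0 ?expR_ge0 ?exprn_ge0 ?sqrtr_ge0.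
have mf : measurable_fun setT (fun p : rV * R => f p.1 p.2).
  apply: measurable_funM.
    by apply: measurable_theat => //; exact: (measurableT_comp (mcenter x)).
  apply: measurable_heat => //; apply: measurable_funD => //.
  exact: measurable_esq.
have f0 y s : 0 <= f y s by rewrite mulr_ge0 ?theat_ge0 ?heat_ge0.
have mtb : measurable_fun setT (fun y : rV => theat c t (y - x)).
  exact: measurable_theat.
rewrite -ge0_integralZl_EFin; last 4 first.
- by [].
- by move=> y _; rewrite lee_fin mulr_ge0 ?theat_ge0 ?bubble_ge0.
- by apply/measurable_EFinP; apply: measurable_funM => //; exact: measurable_bubble.
- exact/ltW/heat_cst_gt0.
rewrite [leLHS](_ : _ = \int[leb]_y \int[mu]_s (f y s)%:E)%E; last first.
  apply: eq_integral => y _.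
  transitivity ((theat c t (y - x))%:E * \int[mu]_s (heat q (1 + esq y) s)%:E)%E.
    by rewrite bubble_heat -!EFinM; congr EFin; ring.
  rewrite -ge0_integralZl_EFin ?theat_ge0//; last 2 first.
  - by move=> s _; rewrite lee_fin heat_ge0.
  - by apply/measurable_EFinP; exact: measurable_heat.
rewrite (tonelli_EFin leb mu mf f0).
apply: (@le_trans _ _ (\int[mu]_s (B s)%:E)%E).
  apply: ge0_le_integral => //.
  - by move=> s _; apply: integral_ge0 => y _; rewrite lee_fin.
  - have mf' : measurable_fun setT (fun p : R * rV => f p.2 p.1).
      exact: (measurable_fun_flip (f := f) mf).
    exact: (measurable_integral_EFin leb (f := fun s y => f y s) mf').
  - exact/measurable_EFinP.
  move=> s _; rewrite /f /B /theat; have [ct|ct] := leP c t.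
    under eq_integral do rewrite mul1r.
    by rewrite mul1r; exact: integral_heat_heat_le.
  by rewrite mul0r integral0_eq// => y _; rewrite !mul0r.
have mBe : measurable_fun setT (EFin \o B) by exact/measurable_EFinP.
(* Change of variable [s = r - t]. *)
rewrite -(ge0_integralT_shift (- t) mBe); last by move=> s; rewrite /= lee_fin.
rewrite le_eqVlt; apply/orP; left; apply/eqP.
apply: eq_integral => r _ /=; congr EFin; rewrite /B addrA subrr add0r.
by rewrite [- t + r]addrC; ring.
Qed.

(** The factor of [bubble x] is the mass found in [integral_theat_mass], so this is superharmonicity
    for the truncated kernel. At fixed total time [r], the integral over [t] is bounded by
    [integral_beta_le]; then [- n/2 + (b - 1) = - q - 1] reassembles the time density of the bubble
    at [x]. *)
Lemma integral_theat_bubble_le c x : 0 < c ->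
  (\int[leb]_y \int[mu]_t (theat c t (y - x) * bubble y)%:E <=
   (S * (c `^ (- b) / b) * bubble x)%:E)%E.
Proof.
move=> c0.
have mf : measurable_fun setT
    (fun p : rV * R => theat c p.2 (p.1 - x) * bubble p.1).
  apply: measurable_funM.
    by apply: measurable_theat => //; exact: (measurableT_comp (mcenter x)).
  exact: (measurableT_comp measurable_bubble).
have f0 y t : 0 <= theat c t (y - x) * bubble y.
  by rewrite mulr_ge0 ?theat_ge0 ?bubble_ge0.
rewrite (tonelli_EFin leb mu
  (f := fun y t => theat c t (y - x) * bubble y) mf f0).
have cq0 := heat_cst_gt0 q0.
rewrite -(@lee_pmul2l _ (heat_cst q)%:E)//.
have mf' : measurable_fun setT
    (fun p : R * rV => theat c p.1 (p.2 - x) * bubble p.2).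
  exact: (measurable_fun_flip (f := fun y t => theat c t (y - x) * bubble y) mf).
rewrite -ge0_integralZl_EFin; last 4 first.
- by [].
- by move=> t _; apply: integral_ge0 => y _; rewrite lee_fin.
- exact: (measurable_integral_EFin leb
    (f := fun t y => theat c t (y - x) * bubble y) mf').
- exact: ltW.
pose G r := ppow (- (n%:R / 2)) r * expR (- ((1 + esq x) * ppow (- 1) r)).
have G0 r : 0 <= G r by rewrite mulr_ge0 ?ppow_ge0 ?expR_ge0.
have mG : measurable_fun setT G.
  apply: measurable_funM; first exact: measurable_ppow.
  apply: measurableT_comp => //; apply: measurableT_comp => //.
  by apply: measurable_funM => //; exact: measurable_ppow.
pose h t r := S * (G r * ((c <= t)%R%:R * ppow (- b - 1) t * ppow (b - 1) (r - t))).
have h0 t r : 0 <= h t r by rewrite !mulr_ge0 ?ppow_ge0 ?(ltW S0).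
have mh : measurable_fun setT (fun p : R * R => h p.1 p.2).
  apply: measurable_funM => //; apply: measurable_funM.
    exact: (measurableT_comp mG).
  apply: measurable_funM.
    apply: measurable_funM; first exact: measurable_ler_nat.
    exact: measurable_ppow.
  by apply: measurable_ppow; exact: measurable_funB.
apply: (@le_trans _ _ (\int[mu]_t \int[mu]_r (h t r)%:E)%E).
  apply: ge0_le_integral => //.
  - move=> t _; rewrite mule_ge0 ?lee_fin ?(ltW cq0)//.
    by apply: integral_ge0 => y _; rewrite lee_fin.
  - apply: measurable_funeM.
    exact: (measurable_integral_EFin leb
      (f := fun t y => theat c t (y - x) * bubble y) mf').
  - exact: (measurable_integral_EFin mu (f := h) mh).
  - by move=> t _; exact: integral_theat_bubble_time.
rewrite (tonelli_EFin mu mu mh h0).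
have cb0 : 0 <= c `^ (- b) / b by rewrite divr_ge0 ?powR_ge0// ltW// divr_gt0.
have x1 : 0 <= S * (c `^ (- b) / b) by rewrite mulr_ge0// ltW.
apply: (@le_trans _ _ (\int[mu]_r
    ((S * (c `^ (- b) / b))%:E * (heat q (1 + esq x) r)%:E))%E).
  apply: ge0_le_integral => //.
  - by move=> r _; apply: integral_ge0 => t _; rewrite lee_fin.
  - have mh' : measurable_fun setT (fun p : R * R => h p.2 p.1).
      exact: (measurable_fun_flip (f := h) mh).
    exact: (measurable_integral_EFin mu (f := fun r t => h t r) mh').
  - apply: measurable_funeM; apply/measurable_EFinP; exact: measurable_heat.
  move=> r _.
  have SG0 : 0 <= S * G r by rewrite mulr_ge0 ?(ltW S0).
  rewrite [leLHS](_ : _ = (S * G r)%:E * \int[mu]_t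
      ((c <= t)%R%:R * ppow (- b - 1) t * ppow (b - 1) (r - t))%:E)%E; last first.
    rewrite -ge0_integralZl_EFin//; last 2 first.
    - by move=> t _; rewrite lee_fin !mulr_ge0 ?ppow_ge0.
    - apply/measurable_EFinP; apply: measurable_funM.
        apply: measurable_funM; first exact: measurable_ler_nat.
        exact: measurable_ppow.
      by apply: measurable_ppow; exact: measurable_funB.
    by apply: eq_integral => t _; rewrite -EFinM; congr EFin; rewrite /h; ring.
  apply: (@le_trans _ _ ((S * G r)%:E * (c `^ (- b) / b * ppow (b - 1) r)%:E)%E).
    apply: lee_wpmul2l; first by rewrite lee_fin.
    exact: (integral_beta_le r b01 c0).
  rewrite -!EFinM lee_fin /G /heat le_eqVlt; apply/orP; left; apply/eqP.
  have -> : - q - 1 = - (n%:R / 2) + (b - 1) by field.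
  by rewrite -(ppowD (- (n%:R / 2))); ring.
rewrite ge0_integralZl_EFin//; last 2 first.
- by move=> r _; rewrite lee_fin heat_ge0.
- by apply/measurable_EFinP; exact: measurable_heat.
rewrite bubble_heat -!EFinM lee_fin le_eqVlt; apply/orP; left; apply/eqP.
by ring.
Qed.

End subordination.

(** * The kernel of the fractional Laplacian *)

Section riesz_kernel.
Context {R : realType} (n : nat) (a : R).
Hypotheses (a0 : 0 < a) (a2 : a < 2) (an : a < n%:R).
Local Notation mu := (@lebesgue_measure R).
Local Notation leb := (@lebesgue_rV R n).
Local Notation rV := 'rV[R]_n.
Local Notation b := (a / 2).
Local Notation Q := ((n%:R + a) / 2).
Local Notation S := (Num.sqrt pi ^+ n).
Implicit Types (x y z : rV) (s t r c : R) (g p : rV -> R).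

Let b01 : 0 < b < 1.
Proof. by rewrite divr_gt0//= ltr_pdivrMr// mul1r. Qed.

Let Q0 : 0 < Q. Proof. by rewrite divr_gt0// addr_gt0// (lt_trans a0). Qed.

Let S0 : 0 < S :> R. Proof. by rewrite exprn_gt0// sqrtr_gt0 pi_gt0. Qed.

Let mcenter x : measurable_fun setT (fun y : rV => y - x).
Proof. exact: measurable_rVB. Qed.

(* [|z| ^ (- (n + a))], with value [0] at the origin. *)
Definition riesz z : R := ppow (- Q) (esq z).

Lemma riesz_ge0 z : 0 <= riesz z. Proof. exact: ppow_ge0. Qed.

Lemma measurable_riesz x : measurable_fun setT (fun y : rV => riesz (y - x)).
Proof. by apply: measurable_ppow; exact: measurable_esq. Qed.

Let mheat x g : measurable_fun setT g ->
  measurable_fun setT (fun w : rV * R => g w.1 * heat Q (esq (w.1 - x)) w.2).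
Proof.
move=> mg; apply: measurable_funM; first exact: (measurableT_comp mg).
apply: measurable_heat => //; apply: measurable_esq.
exact: (measurableT_comp (mcenter x)).
Qed.

Let mtheat x g c : measurable_fun setT g ->
  measurable_fun setT (fun w : rV * R => theat a c w.2 (w.1 - x) * g w.1).
Proof.
move=> mg; apply: measurable_funM; last exact: (measurableT_comp mg).
by apply: measurable_theat => //; exact: (measurableT_comp (mcenter x)).
Qed.

(** At [y = x] the time integral of the Gaussians diverges while [riesz] is 0 by convention, which
    is why [g] has to vanish there. *)
Lemma integral_riesz_heat x g : measurable_fun setT g -> (forall y, 0 <= g y) ->
  (forall y, esq (y - x) = 0 -> g y = 0) ->
  ((heat_cst Q)%:E * \int[leb]_y (g y * riesz (y - x))%:E =
   \int[mu]_t \int[leb]_y (g y * heat Q (esq (y - x)) t)%:E)%E.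
Proof.
move=> mg g0 gx.
rewrite -(tonelli_EFin leb mu (f := fun y t => g y * heat Q (esq (y - x)) t)
  (mheat x mg)); last by move=> y t; rewrite mulr_ge0 ?heat_ge0.
have cQ0 := heat_cst_gt0 Q0.
rewrite -ge0_integralZl_EFin ?(ltW cQ0)//; last 2 first.
- by move=> y _; rewrite lee_fin mulr_ge0 ?riesz_ge0.
- by apply/measurable_EFinP; apply: measurable_funM => //; exact: measurable_riesz.
apply: eq_integral => y _.
have [z0|] := eqVneq (esq (y - x)) 0.
  rewrite gx// mul0r mule0 integral0_eq// => t _.
  by rewrite mul0r.
move=> zn0; have z0 : 0 < esq (y - x) by rewrite lt0r zn0 esq_ge0.
transitivity ((g y)%:E * \int[mu]_t (heat Q (esq (y - x)) t)%:E)%E.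
  by rewrite integral_heat// -!EFinM /riesz gt0_ppow//; congr EFin; ring.
rewrite -ge0_integralZl_EFin//; last 2 first.
- by move=> t _; rewrite lee_fin heat_ge0.
- by apply/measurable_EFinP; exact: measurable_heat.
Qed.

(** The passage [c -> 0]. The times [t >= 1 / (k + 1)] exhaust the half-line, and each truncated
    integral of [g] is at most the truncated, hence the full, integral of [p]. It serves with [g]
    and [p] the negative and positive parts of a symmetric difference. *)
Lemma riesz_integral_le x g p :
  measurable_fun setT g -> (forall y, 0 <= g y) ->
  (forall y, esq (y - x) = 0 -> g y = 0) ->
  measurable_fun setT p -> (forall y, 0 <= p y) ->
  (forall y, esq (y - x) = 0 -> p y = 0) ->
  (forall c, (0 < c)%R ->
    \int[leb]_y \int[mu]_t (theat a c t (y - x) * g y)%:E <=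
    \int[leb]_y \int[mu]_t (theat a c t (y - x) * p y)%:E)%E ->
  (\int[leb]_y (g y * riesz (y - x))%:E <=
   \int[leb]_y (p y * riesz (y - x))%:E)%E.
Proof.
move=> mg g0 gx mp p0 px le_c.
have cQ0 := heat_cst_gt0 Q0.
rewrite -(@lee_pmul2l _ (heat_cst Q)%:E)//.
rewrite (integral_riesz_heat mg g0 gx) (integral_riesz_heat mp p0 px).
have h0 (f : rV -> R) : (forall y, 0 <= f y) -> forall t,
    (0 <= \int[leb]_y (f y * heat Q (esq (y - x)) t)%:E)%E.
  by move=> f0 t; apply: integral_ge0 => y _; rewrite lee_fin mulr_ge0 ?heat_ge0.
have mh (f : rV -> R) : measurable_fun setT f -> (forall y, 0 <= f y) ->
    measurable_fun setT (fun t =>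
      \int[leb]_y (f y * heat Q (esq (y - x)) t)%:E)%E.
  move=> mf f0.
  apply: (measurable_integral_EFin leb
    (f := fun t y => f y * heat Q (esq (y - x)) t)).
    exact: (measurable_fun_flip (f := fun y t => f y * heat Q (esq (y - x)) t)
      (mheat x mf)).
  by move=> t y; rewrite mulr_ge0 ?heat_ge0.
have tE (f : rV -> R) (c : R) : measurable_fun setT f -> (forall y, 0 <= f y) ->
    (\int[leb]_y \int[mu]_t (theat a c t (y - x) * f y)%:E =
     \int[mu]_(t in `[c, +oo[) \int[leb]_y (f y * heat Q (esq (y - x)) t)%:E)%E.
  move=> mf f0.
  rewrite (tonelli_EFin leb mu (f := fun y t => theat a c t (y - x) * f y)
    (mtheat x c mf)); last by move=> y t; rewrite mulr_ge0 ?theat_ge0.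
  rewrite [RHS]integral_mkcond; apply: eq_integral => t _.
  rewrite patchE; case: ifPn => [|/negP tc].
    rewrite inE/= in_itv/= andbT => ct.
    by apply: eq_integral => y _; rewrite /theat ct mul1r mulrC.
  rewrite integral0_eq// => y _; rewrite /theat.
  have -> : (c <= t) = false.
    by apply/negP => ct; apply: tc; rewrite inE/= in_itv/= ct.
  by rewrite !mul0r.
apply: (@ge0_integralT_exhaust_le _ _ R mu
  (fun k => `[k.+1%:R^-1, +oo[%classic)) => //.
- move=> i j ij; apply/subsetPset => t /=; rewrite !in_itv/= !andbT.
  by apply: le_trans; rewrite lef_pV2 ?posrE// ler_nat.
- exact: mh.
- exact: h0.
- move=> t tE'; apply: integral0_eq => y _.
  rewrite /heat ppow_le0 ?mul0r ?mulr0// leNgt; apply/negP => t0; apply: tE'.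
  exists (Num.truncn t^-1) => //=; rewrite in_itv/= andbT.
  rewrite -[leRHS]invrK lef_pV2 ?posrE ?invr_gt0//.
  exact: (ltW (truncnS_gt _)).
- move=> k; rewrite -tE//.
  apply: (le_trans (le_c _ _)); first by rewrite invr_gt0.
  rewrite tE//; apply: ge0_subset_integral => //; first exact: mh.
  by move=> t _; exact: h0.
Qed.

(** The size of a symmetric difference of a bounded function with Lipschitz gradient. Against the
    kernel, the square is integrable at the origin because [a < 2], and the cap 1 at infinity
    because [0 < a]. *)
Definition bump z : R := Num.min 1 (esq z).

Lemma bump_ge0 z : 0 <= bump z.
Proof. by rewrite /bump le_min ler01 esq_ge0. Qed.

Lemma measurable_bump x : measurable_fun setT (fun y : rV => bump (y - x)).
Proof. by apply: measurable_minr => //; exact: measurable_esq. Qed.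

(** The Gaussian is the square of the one at time [2 t]: one factor absorbs |z|^2 through
    [esq z * e <= 2 * t], the other remains. *)
Lemma bump_gauss_le z t : 0 < t ->
  bump z * expR (- (t^-1 * esq z)) <=
  2 * Num.min 1 t * expR (- ((2 * t)^-1 * esq z)).
Proof.
move=> t0; set e := expR (- ((2 * t)^-1 * esq z)).
have eE : expR (- (t^-1 * esq z)) = e * e.
  by rewrite /e -expRD; congr expR; field; rewrite gt_eqF.
have e0 : 0 < e by exact: expR_gt0.
have e1 : e <= 1.
  by rewrite /e -expR0 ler_expR oppr_le0 mulr_ge0 ?esq_ge0// invr_ge0 mulr_ge0 ?ltW.
have z0 := esq_ge0 z.
rewrite eE mulrA ler_pM2r//.
have b1 : bump z <= 1 by rewrite /bump ge_min lexx.
have bz : bump z <= esq z by rewrite /bump ge_min lexx orbT.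
have ze : esq z * e <= 2 * t.
  have : 1 + (2 * t)^-1 * esq z <= e^-1.
    by rewrite -expRN opprK expR_ge1Dx.
  rewrite -(ler_pM2r e0) mulVf ?gt_eqF// => h.
  have h2 : (2 * t)^-1 * esq z * e <= 1.
    by apply: le_trans h; rewrite ler_pM2r// lerDr.
  rewrite -[leLHS](_ : 2 * t * ((2 * t)^-1 * esq z * e) = _); last first.
    by field; rewrite gt_eqF.
  by rewrite -[leRHS]mulr1 ler_pM2l// mulr_gt0.
have [t1|t1] := leP 1 t.
  rewrite mulr1; apply: (@le_trans _ _ (1 * 1)); last by rewrite mul1r ler1n.
  by rewrite ler_pM ?bump_ge0 ?(ltW e0).
by apply: le_trans ze; rewrite ler_pM2r.
Qed.

(** In time, the bound becomes a multiple of the integral of [min 1 t * t ^ (- b - 1)], which is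
    split at [t = 1]. Translation invariance makes [M] independent of [x]. *)
Lemma integral_bump_riesz_lty :
  exists2 M : R, 0 < M &
    forall x, (\int[leb]_y (bump (y - x) * riesz (y - x))%:E <= M%:E)%E.
Proof.
have cQ0 := heat_cst_gt0 Q0.
(* The first 2 comes from [bump_gauss_le], the rest from the mass of the Gaussian at time
   [2 * t]. *)
pose C : R := 2 * (S * 2 `^ (n%:R / 2)).
have C0 : 0 < C by rewrite !mulr_gt0 ?powR_gt0.
pose N : R := C * ((1 - b)^-1 + 1 / b).
case/andP: (b01) => b0 b1.
have N0 : 0 < N.
  by rewrite mulr_gt0// addr_gt0 ?invr_gt0 ?subr_gt0// divr_gt0.
exists ((heat_cst Q)^-1 * N); first by rewrite mulr_gt0 ?invr_gt0.
move=> x; rewrite -(@lee_pmul2l _ (heat_cst Q)%:E)// -EFinM mulrA divff ?gt_eqF//.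
rewrite mul1r integral_riesz_heat; last 3 first.
- exact: measurable_bump.
- by move=> y; exact: bump_ge0.
- by move=> y yx0; rewrite /bump yx0 min_r.
pose h1 t : R := (t <= 1)%R%:R * ppow (- b) t.
pose h2 t : R := (1 <= t)%R%:R * ppow (- b - 1) t.
have h10 t : 0 <= h1 t by rewrite mulr_ge0 ?ppow_ge0.
have h20 t : 0 <= h2 t by rewrite mulr_ge0 ?ppow_ge0.
have mh1 : measurable_fun setT h1.
  by apply: measurable_funM; [exact: measurable_ler_nat|exact: measurable_ppow].
have mh2 : measurable_fun setT h2.
  by apply: measurable_funM; [exact: measurable_ler_nat|exact: measurable_ppow].
apply: (@le_trans _ _ (\int[mu]_t (C%:E * ((h1 t)%:E + (h2 t)%:E)))%E).
  apply: ge0_le_integral => //.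
  - move=> t _; apply: integral_ge0 => y _.
    by rewrite lee_fin mulr_ge0 ?bump_ge0 ?heat_ge0.
  - apply: (measurable_integral_EFin leb
      (f := fun t y => bump (y - x) * heat Q (esq (y - x)) t)).
      exact: (measurable_fun_flip
        (f := fun y t => bump (y - x) * heat Q (esq (y - x)) t)
        (mheat x (measurable_bump x))).
    by move=> t y; rewrite mulr_ge0 ?bump_ge0 ?heat_ge0.
  - apply: measurable_funeM; apply/measurable_EFinP.
    exact: (measurable_funD mh1 mh2).
  move=> t _; have [t0|t0] := ltP 0 t; last first.
    rewrite integral0_eq; last first.
      by move=> y _; rewrite /heat (ppow_le0 _ t0) mul0r mulr0.
    by rewrite -EFinD -EFinM lee_fin mulr_ge0 ?addr_ge0// ltW.
  have tQ : 0 <= t `^ (- Q - 1) by exact: powR_ge0.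
  have m0 : 0 <= Num.min 1 t by rewrite le_min ler01 ltW.
  apply: (@le_trans _ _ (\int[leb]_y ((t `^ (- Q - 1) * (2 * Num.min 1 t))%:E *
      (expR (- ((2 * t)^-1 * esq (y - x))))%:E))%E).
    apply: ge0_le_integral => //.
    - by move=> y _; rewrite lee_fin mulr_ge0 ?bump_ge0 ?heat_ge0.
    - apply/measurable_EFinP; apply: measurable_funM; first exact: measurable_bump.
      by apply: measurable_heat => //; exact: measurable_esq.
    - apply: measurable_funeM; apply/measurable_EFinP.
      apply: measurableT_comp => //; apply: measurableT_comp => //.
      by apply: measurable_funM => //; exact: measurable_esq.
    move=> y _; rewrite -EFinM lee_fin /heat !gt0_ppow// powR_inv1 ?(ltW t0)//.
    rewrite mulrCA -mulrA ler_wpM2l// [esq _ / t]mulrC.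
    exact: bump_gauss_le.
  rewrite ge0_integralZl_EFin//; last 2 first.
  - apply/measurable_EFinP; apply: measurableT_comp => //.
    apply: measurableT_comp => //.
    by apply: measurable_funM => //; exact: measurable_esq.
  - by rewrite !mulr_ge0.
  rewrite integral_gauss_time; last by rewrite mulr_gt0.
  rewrite -EFinD -!EFinM lee_fin powRM ?(ltW t0)//.
  have tE : t `^ (- Q - 1) * t `^ (n%:R / 2) = t `^ (- b - 1).
    by rewrite -gt0_powRD//; congr powR; field.
  apply: (@le_trans _ _ (C * (Num.min 1 t * t `^ (- b - 1)))).
    by rewrite -tE le_eqVlt /C; apply/orP; left; apply/eqP; ring.
  rewrite ler_pM2l// /h1 /h2 !gt0_ppow//.
  have tb1 : 0 <= t `^ (- b - 1) by exact: powR_ge0.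
  have tb : t `^ (- b) = t * t `^ (- b - 1) by exact: powR_succ.
  have [t1|t1] := leP 1 t.
    by rewrite !mul1r lerDr mulr_ge0 ?powR_ge0.
  by rewrite (ltW t1) mul0r addr0 !mul1r tb.
rewrite ge0_integralZl_EFin ?(ltW C0)//; last 2 first.
- by move=> t _; rewrite adde_ge0// lee_fin.
- by apply/measurable_EFinP; exact: (measurable_funD mh1 mh2).
have -> : (N%:E = C%:E * ((1 - b)^-1 + 1 / b)%:E)%E by rewrite -EFinM.
rewrite lee_pmul2l// ge0_integralD//; last 4 first.
- by move=> t _; rewrite lee_fin.
- exact/measurable_EFinP.
- by move=> t _; rewrite lee_fin.
- exact/measurable_EFinP.
rewrite EFinD; apply: leeD.
  exact: integral_ppow_head.
by rewrite integral_ppow_tail// powR1.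
Qed.

End riesz_kernel.

(** * Symmetric differences *)

Section symmetric_difference.
Context {R : realType} (n : nat) (a : R).
Hypotheses (a0 : 0 < a) (a2 : a < 2) (an : a < n%:R).
Local Notation mu := (@lebesgue_measure R).
Local Notation leb := (@lebesgue_rV R n).
Local Notation rV := 'rV[R]_n.
Local Notation b := (a / 2).
Local Notation S := (Num.sqrt pi ^+ n).
Implicit Types (x y z : rV) (s t r c : R) (f g p u : rV -> R).

Let mcenter x : measurable_fun setT (fun y : rV => y - x).
Proof. exact: measurable_rVB. Qed.

Let mreflect x : measurable_fun setT (fun y : rV => x - y).
Proof. exact: measurable_rVB. Qed.

Lemma esqN z : esq (- z) = esq z.
Proof. by apply: eq_bigr => i _; rewrite mxE sqrrN. Qed.

Lemma reflectB x y : x + x - y - x = - (y - x).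
Proof. by rewrite addrAC addrK opprB. Qed.

Definition theat_int c x f : \bar R :=
  (\int[leb]_y \int[mu]_t (theat a c t (y - x) * f y)%:E)%E.

Lemma theat_intD c x f g :
  measurable_fun setT f -> (forall y, 0 <= f y) ->
  measurable_fun setT g -> (forall y, 0 <= g y) ->
  theat_int c x (f \+ g) = (theat_int c x f + theat_int c x g)%E.
Proof.
move=> mf f0 mg g0.
have mt h : measurable_fun setT h ->
    measurable_fun setT (fun w : rV * R => theat a c w.2 (w.1 - x) * h w.1).
  move=> mh; apply: measurable_funM; last exact: (measurableT_comp mh).
  by apply: measurable_theat => //; exact: (measurableT_comp (mcenter x)).
have t0 h : (forall y, 0 <= h y) -> forall y t, 0 <= theat a c t (y - x) * h y.
  by move=> h0 y t; rewrite mulr_ge0 ?theat_ge0.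
rewrite /theat_int -ge0_integralD//; last 4 first.
- by move=> y _; apply: integral_ge0 => t _; rewrite lee_fin t0.
- exact: (measurable_integral_EFin mu
    (f := fun y t => theat a c t (y - x) * f y) (mt f mf) (t0 f f0)).
- by move=> y _; apply: integral_ge0 => t _; rewrite lee_fin t0.
- exact: (measurable_integral_EFin mu
    (f := fun y t => theat a c t (y - x) * g y) (mt g mg) (t0 g g0)).
apply: eq_integral => y _.
have mty : measurable_fun setT (fun t : R => theat a c t (y - x)).
  exact: measurable_theat.
rewrite -ge0_integralD//.
- by apply: eq_integral => t _; rewrite -EFinD -mulrDr.
- by move=> t _; rewrite lee_fin t0.
- by apply/measurable_EFinP; apply: measurable_funM.
- by move=> t _; rewrite lee_fin t0.
- by apply/measurable_EFinP; apply: measurable_funM.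
Qed.

Lemma theat_int_cst c x k : 0 < c -> 0 <= k ->
  theat_int c x (fun=> k) = (k * (S * (c `^ (- b) / b)))%:E.
Proof.
move=> c0 k0.
have mt : measurable_fun setT (fun w : rV * R => theat a c w.2 (w.1 - x)).
  by apply: measurable_theat => //; exact: (measurableT_comp (mcenter x)).
have t0 y t : 0 <= theat a c t (y - x) by exact: theat_ge0.
rewrite EFinM -(integral_theat_mass a0 x c0) /theat_int.
rewrite -ge0_integralZl_EFin//; last 2 first.
- by move=> y _; apply: integral_ge0 => t _; rewrite lee_fin t0.
- exact: (measurable_integral_EFin mu (f := fun y t => theat a c t (y - x)) mt t0).
apply: eq_integral => y _.
rewrite -ge0_integralZl_EFin//; last 2 first.
- by move=> t _; rewrite lee_fin.
- by apply/measurable_EFinP; exact: measurable_theat.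
by apply: eq_integral => t _; rewrite -EFinM mulrC.
Qed.

Lemma theat_int_reflect c x f : measurable_fun setT f -> (forall y, 0 <= f y) ->
  theat_int c x (fun y => f (x + x - y)) = theat_int c x f.
Proof.
move=> mf f0.
have mt : measurable_fun setT
    (fun w : rV * R => theat a c w.2 (w.1 - x) * f w.1).
  apply: measurable_funM; last exact: (measurableT_comp mf).
  by apply: measurable_theat => //; exact: (measurableT_comp (mcenter x)).
have t0 y t : 0 <= theat a c t (y - x) * f y by rewrite mulr_ge0 ?theat_ge0.
pose G y := (\int[mu]_t (theat a c t (y - x) * f y)%:E)%E.
have mG : measurable_fun setT G.
  exact: (measurable_integral_EFin mu
    (f := fun y t => theat a c t (y - x) * f y) mt t0).
have G0 y : (0 <= G y)%E by apply: integral_ge0 => t _; rewrite lee_fin.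
rewrite /theat_int -/G.
rewrite -[RHS](ge0_integral_rV_reflect (x + x) mG G0).
by apply: eq_integral => y _; rewrite /G /theat reflectB esqN.
Qed.

(** Pairing [y] with its reflection in [x] cancels the first-order term of [u]. *)
Definition symdiff u x y : R := u x + u x - u y - u (x + x - y).

Lemma measurable_symdiff u x : measurable_fun setT u ->
  measurable_fun setT (symdiff u x).
Proof.
move=> mu'; apply: measurable_funB; first by apply: measurable_funB.
exact: (measurableT_comp mu').
Qed.

Lemma symdiff_riesz_integrable u x (C : R) :
  measurable_fun setT u -> (forall y, `|symdiff u x y| <= C * bump (y - x)) ->
  leb.-integrable setT (fun y => (symdiff u x y * riesz a (y - x))%:E).
Proof.
move=> mu' uC.
have [M M0 HM] := @integral_bump_riesz_lty R n a a0 a2 an.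
have mr := @measurable_riesz R n a x.
have mb := @measurable_bump R n x.
have iM : leb.-integrable setT (fun y => (bump (y - x) * riesz a (y - x))%:E).
  apply/integrableP; split; first by apply/measurable_EFinP; exact: measurable_funM.
  under eq_integral do rewrite gee0_abs ?lee_fin ?mulr_ge0 ?bump_ge0 ?riesz_ge0//.
  exact: (le_lt_trans (HM x) (ltry _)).
apply: (le_integrable _ _ _ (integrableZl _ C iM)) => //.
  apply/measurable_EFinP; apply: measurable_funM => //.
  exact: measurable_symdiff.
move=> y _; rewrite -EFinM /= lee_fin !normrM.
rewrite (ger0_norm (bump_ge0 _)) (ger0_norm (riesz_ge0 _ _)) mulrA.
rewrite ler_wpM2r ?riesz_ge0//; apply: le_trans (uC y) _.
by rewrite ler_wpM2r ?bump_ge0// ler_norm.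
Qed.

(** With [p] and [g] the positive and negative parts of [D], one has [w y + w (x + x - y) + p y = w
    x + w x + g y]. Integrated against the truncated kernel, the two bubble terms on the left are
    equal by symmetry and at most the constant term on the right, so the integral of [g] is at most
    that of [p]. Then [c] tends to 0. *)
Lemma bubble_superharmonic x (C : R) :
  (forall y, `|symdiff (bubble a) x y| <= C * bump (y - x)) ->
  (0 <= \int[leb]_y (symdiff (bubble a) x y * riesz a (y - x))%:E)%E.
Proof.
move=> wC; set w := @bubble R n a; set D := symdiff w x.
have mw : measurable_fun setT w by exact: measurable_bubble.
have w0 y : 0 <= w y by exact: bubble_ge0.
have mD : measurable_fun setT D by exact: measurable_symdiff.
pose p y := Num.max (D y) 0; pose g y := Num.max (- D y) 0.
have p0 y : 0 <= p y by rewrite le_max lexx orbT.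
have g0 y : 0 <= g y by rewrite le_max lexx orbT.
have mp : measurable_fun setT p by exact: measurable_maxr.
have mg : measurable_fun setT g by apply: measurable_maxr => //; exact: measurableT_comp.
have Dx y : esq (y - x) = 0 -> D y = 0.
  move=> yx; apply/eqP; rewrite -normr_le0; apply: le_trans (wC y) _.
  by rewrite /bump yx min_r// mulr0.
have px y : esq (y - x) = 0 -> p y = 0 by move=> /Dx yx; rewrite /p yx maxxx.
have gx y : esq (y - x) = 0 -> g y = 0 by move=> /Dx yx; rewrite /g yx oppr0 maxxx.
have mwr : measurable_fun setT (fun y => w (x + x - y)).
  exact: (measurableT_comp mw).
(* The arithmetic in the extended reals: only [Jc], which is finite, is cancelled. *)
have cancel (J1 J2 Jw Jp Jg Jc : \bar R) (v T : R) :
    (J1 + Jp = Jc + Jg -> J1 = Jw + J2 -> J2 = Jw ->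
     Jc = ((v + v)%R * T)%:E -> Jw <= (T * v)%:E -> Jg <= Jp)%E.
  move=> eqJ E1 E2 E3 Jw_le; rewrite {}E1 {}E2 {}E3 in eqJ.
  rewrite -(@leeD2lE _ ((v + v) * T)%:E)// -eqJ; apply: leeD2r.
  rewrite (_ : (v + v) * T = T * v + T * v); last by ring.
  by rewrite EFinD; apply: leeD.
have le_gp : (\int[leb]_y (g y * riesz a (y - x))%:E <=
    \int[leb]_y (p y * riesz a (y - x))%:E)%E.
  apply: (riesz_integral_le a0 an mg g0 gx mp p0 px) => c c0.
  rewrite -/(theat_int c x g) -/(theat_int c x p).
  have eqJ : (theat_int c x ((w \+ (fun y => w (x + x - y))) \+ p) =
      theat_int c x ((fun=> w x + w x) \+ g)).
    congr theat_int; apply/funext => y /=.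
    rewrite /p /g /D /symdiff; have [h|h] := leP 0 (w x + w x - w y - w (x + x - y)).
      by rewrite max_r ?oppr_le0//; ring.
    by rewrite max_l ?oppr_ge0 ?(ltW h)//; ring.
  have wr0 y : 0 <= w (x + x - y) by exact: w0.
  have E1 := theat_intD c x (measurable_funD mw mwr)
    (fun y => addr_ge0 (w0 y) (wr0 y)) mp p0.
  have E2 := theat_intD c x mw w0 mwr wr0.
  have E3 := theat_int_reflect c x mw w0.
  have ww0 := addr_ge0 (w0 x) (w0 x).
  have E4 := theat_intD c x (measurable_cst (w x + w x)) (fun=> ww0) mg g0.
  have E5 := theat_int_cst x c0 ww0.
  have Jw : (theat_int c x w <= (S * (c `^ (- b) / b) * w x)%:E)%E.
    exact: integral_theat_bubble_le.
  exact: (cancel _ _ _ _ _ _ _ _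
    (etrans (esym E1) (etrans eqJ E4)) E2 E3 E5 Jw).
have iD := symdiff_riesz_integrable mw wC.
rewrite integralE sube_ge0; last by rewrite integrable_pos_fin_num ?orbT.
rewrite [leLHS](_ : _ = \int[leb]_y (g y * riesz a (y - x))%:E)%E; last first.
  apply: eq_integral => y _; rewrite funenegE -EFinN -EFin_max -mulNr.
  by rewrite /g maxr_pMl ?riesz_ge0// mul0r.
rewrite [leRHS](_ : _ = \int[leb]_y (p y * riesz a (y - x))%:E)%E//.
apply: eq_integral => y _; rewrite funeposE -EFin_max.
by rewrite /p maxr_pMl ?riesz_ge0// mul0r.
Qed.

End symmetric_difference.

(** * Truncated integrals *)

Section truncation.
Context {R : realType} (n : nat) (a : R).
Hypotheses (a0 : 0 < a) (a2 : a < 2) (an : a < n%:R).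
Local Notation leb := (@lebesgue_rV R n).
Local Notation rV := 'rV[R]_n.
Local Notation Q := ((n%:R + a) / 2).
Implicit Types (x y z : rV) (e : R) (u f : rV -> R).

Let mcenter x : measurable_fun setT (fun y : rV => y - x).
Proof. exact: measurable_rVB. Qed.

Let mreflect x : measurable_fun setT (fun y : rV => x - y).
Proof. exact: measurable_rVB. Qed.

Lemma enorm_esq z : enorm z = Num.sqrt (esq z). Proof. by []. Qed.

Lemma enormN z : enorm (- z) = enorm z.
Proof. by rewrite !enorm_esq esqN. Qed.

Lemma enorm_riesz z : (enorm z `^ (n%:R + a))^-1 = riesz a z.
Proof.
rewrite /riesz; have na0 : 0 < n%:R + a by rewrite addr_gt0// (lt_trans a0).
have [z0|z0] := ltP 0 (esq z); last first.
  rewrite ppow_le0// enorm_esq (ler0_sqrtr z0) powR0 ?invr0//.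
  by rewrite gt_eqF.
rewrite gt0_ppow// -powRN enorm_esq -powR12_sqrt ?ltW// -powRrM.
by congr powR; ring.
Qed.

Definition far e x y : R := (e <= enorm (y - x))%R%:R.

Lemma measurable_far e x : measurable_fun setT (far e x).
Proof.
apply: measurable_ler_nat => //.
rewrite (_ : (fun _ => _) = (fun y : rV => esq (y - x) `^ 2^-1)); last first.
  by apply/funext => y; rewrite enorm_esq powR12_sqrt// esq_ge0.
by apply: (measurableT_comp (measurable_powR _)); exact: measurable_esq.
Qed.

(** Away from [x], integrability of the kernel thus follows from that of [bump * riesz]. *)
Lemma far_bump_le e x y : 0 < e -> far e x y * Num.min 1 (e ^+ 2) <= bump (y - x).
Proof.
move=> e0; rewrite /far; have [h|_] := leP e (enorm (y - x)); last first.
  by rewrite mul0r bump_ge0.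
rewrite mul1r /bump le_min ge_min lexx/= ge_min; apply/orP; right.
rewrite -[leRHS]sqr_sqrtr ?esq_ge0// -enorm_esq.
by rewrite ler_sqr ?nnegrE// ?sqrtr_ge0// ltW.
Qed.

Lemma integral_rV_reflect x (f : rV -> \bar R) : measurable_fun setT f ->
  (\int[leb]_y f (x + x - y)%R = \int[leb]_y f y)%E.
Proof.
move=> mf; rewrite integralE [RHS]integralE.
have mp := measurable_funepos mf; have mn := measurable_funeneg mf.
congr (_ - _)%E.
  rewrite -(ge0_integral_rV_reflect (x + x) mp (funepos_ge0 f)).
  by apply: eq_integral => y _; rewrite !funeposE.
rewrite -(ge0_integral_rV_reflect (x + x) mn (funeneg_ge0 f)).
by apply: eq_integral => y _; rewrite !funenegE.
Qed.

(** The truncated region is symmetric about [x], so the integral is the mean of itself and of its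
    reflection; both are integrable since [u] is bounded. *)
Lemma frac_laplacian_truncE u x e (B : R) : 0 < e ->
  measurable_fun setT u -> (forall y, `|u y| <= B) ->
  frac_laplacian_trunc a u x e =
  fine (\int[leb]_y (far e x y * (symdiff u x y * riesz a (y - x)))%:E)%E / 2.
Proof.
move=> e0 mu uB.
have [M M0 HM] := @integral_bump_riesz_lty R n a a0 a2 an.
have mr := @measurable_riesz R n a x.
have mb := @measurable_bump R n x.
have mfar := measurable_far e x.
pose G y : R := far e x y * ((u x - u y) * riesz a (y - x)).
have mG : measurable_fun setT G.
  by apply: measurable_funM => //; apply: measurable_funM => //; exact: measurable_funB.
have iM : leb.-integrable setT (fun y => (bump (y - x) * riesz a (y - x))%:E).
  apply/integrableP; split; first by apply/measurable_EFinP; exact: measurable_funM.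
  under eq_integral do rewrite gee0_abs ?lee_fin ?mulr_ge0 ?bump_ge0 ?riesz_ge0//.
  exact: (le_lt_trans (HM x) (ltry _)).
have m0 : 0 < Num.min 1 (e ^+ 2) by rewrite lt_min ltr01 exprn_gt0.
have B0 : 0 <= B by exact: le_trans (uB x).
(* Where |y - x| >= e, [bump] is at least [min 1 (e ^ 2)], so [K * bump] dominates
   [|u x - u y| <= 2 * B]. *)
have [K KE] : exists K, K = 2 * B / Num.min 1 (e ^+ 2) by exists (2 * B / Num.min 1 (e ^+ 2)).
have K0 : 0 <= K by rewrite KE divr_ge0 ?mulr_ge0 ?(ltW m0).
have iG : leb.-integrable setT (EFin \o G).
  apply: (le_integrable _ _ _ (integrableZl _ K iM)) => //.
    exact/measurable_EFinP.
  move=> y _; rewrite -EFinM /= lee_fin !normrM.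
  have far0 : 0 <= far e x y by [].
  rewrite (ger0_norm far0) (ger0_norm (bump_ge0 _)) (ger0_norm (riesz_ge0 _ _)).
  rewrite !mulrA ler_wpM2r ?riesz_ge0//.
  have uu : `|u x - u y| <= 2 * B.
    by rewrite (le_trans (ler_normB _ _))// mulr_natl mulr2n lerD.
  rewrite (ger0_norm K0) KE [leRHS]mulrAC ler_pdivlMr// mulrAC mulrC.
  by rewrite ler_pM ?mulr_ge0 ?(ltW m0)//; exact: far_bump_le.
have EG : frac_laplacian_trunc a u x e = fine (\int[leb]_y (G y)%:E)%E.
  rewrite /frac_laplacian_trunc /Rintegral integral_mkcond; congr fine.
  apply: eq_integral => y _; rewrite patchE /G /far.
  have -> : (u x - u y) / enorm (x - y) `^ (n%:R + a) = (u x - u y) * riesz a (y - x).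
    by rewrite -enorm_riesz -(enormN (x - y)) opprB.
  case: ifPn => [|/negP].
    by rewrite inE/= => ->; rewrite mul1r.
  case: (leP e (enorm (y - x))) => h; last by rewrite mul0r.
  by move=> hh; exfalso; apply: hh; rewrite inE.
rewrite EG.
have iGr : leb.-integrable setT (EFin \o (fun y => G (x + x - y))).
  have mGr : measurable_fun setT (fun y => G (x + x - y)).
    exact: (measurableT_comp mG).
  apply/integrableP; split; first exact/measurable_EFinP.
  have mGa : measurable_fun setT (fun y => `|(G y)%:E|%E).
    exact: (measurableT_comp (@abse_measurable R setT) (measurableT_comp (@EFin_measurable R setT) mG)).
  rewrite (integral_rV_reflect x mGa).
  by have /integrableP[] := iG.
have -> : (\int[leb]_y (far e x y * (symdiff u x y * riesz a (y - x)))%:E =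
    \int[leb]_y (G y)%:E + \int[leb]_y (G y)%:E)%E.
  have mGe : measurable_fun setT (EFin \o G) by exact/measurable_EFinP.
  rewrite -[X in (_ + X)%E](integral_rV_reflect x mGe) -integralD//.
  apply: eq_integral => y _ /=; rewrite -EFinD; congr EFin.
  rewrite /G /far /riesz reflectB enormN esqN /symdiff.
  by ring.
have fG : (\int[leb]_y (G y)%:E)%E \is a fin_num by exact: integrable_fin_num.
by rewrite (fineD fG fG); move: (fine _) => I; field.
Qed.

(** Dominated convergence along sequences, the symmetrized integrand being its own majorant. *)
Lemma cvg_frac_laplacian_trunc u x (B C : R) :
  measurable_fun setT u -> (forall y, `|u y| <= B) ->
  (forall y, `|symdiff u x y| <= C * bump (y - x)) ->
  frac_laplacian_trunc a u x e @[e --> 0^'+] -->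
  fine (\int[leb]_y (symdiff u x y * riesz a (y - x))%:E)%E / 2.
Proof.
move=> mu uB uC; apply/cvg_at_rightP => e_ [e_gt0 e_cvg].
have iD := symdiff_riesz_integrable a0 a2 an mu uC.
have mr := @measurable_riesz R n a x.
have mD := measurable_symdiff x mu.
pose I e := (\int[leb]_y (far e x y * (symdiff u x y * riesz a (y - x)))%:E)%E.
rewrite (_ : (fun _ => _) = (fun k => fine (I (e_ k)) / 2)); last first.
  by apply/funext => k; rewrite (frac_laplacian_truncE x (e_gt0 k) mu uB).
apply: cvgMl; apply: fine_cvg.
rewrite fineK ?integrable_fin_num//.
apply: (@dominated_cvg _ _ _ _ _ measurableT
  (fun k y => (far (e_ k) x y * (symdiff u x y * riesz a (y - x)))%:E) _
  (fun y => `|(symdiff u x y * riesz a (y - x))%:E|%E)).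
- move=> k; apply/measurable_EFinP; apply: measurable_funM.
    exact: measurable_far.
  exact: measurable_funM.
(* For [y] different from [x] the cutoff is eventually 1; at [y = x] the symmetric difference
   vanishes. *)
- move=> y _; apply: cvg_near_cst.
  have [yx0|yx0] := leP (enorm (y - x)) 0.
    have bu0 : bump (y - x) = 0.
      apply/eqP; rewrite eq_le bump_ge0 andbT /bump ge_min; apply/orP; right.
      by rewrite -sqrtr_eq0 -enorm_esq eq_le yx0 sqrtr_ge0.
    have D0 : symdiff u x y = 0.
      by apply/eqP; rewrite -normr_le0 (le_trans (uC y))// bu0 mulr0.
    by apply: nearW => k; rewrite D0 !(mul0r, mulr0).
  move/cvgrPdist_lt: e_cvg => /(_ _ yx0); apply: filterS => k.
  rewrite sub0r normrN gtr0_norm// => ek.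
  by rewrite /far ltW// mul1r.
- by [].
- exact: integrable_abse.
- move=> k y _; rewrite lee_fin /far.
  case: (e_ k <= _); first by rewrite mul1r.
  by rewrite mul0r normr0 normr_ge0.
Qed.

End truncation.

(** * Directional derivatives *)

Section directional_derivative.
Context {R : realType} (n : nat).
Local Notation rV := 'rV[R]_n.
Implicit Types (x y z v : rV).

Definition dotp x y : R := \sum_(i < n) x ord0 i * y ord0 i.

Lemma esq_line x v (s : R) : esq (s *: v + x) = esq x + s * (2 * dotp x v) + s ^+ 2 * esq v.
Proof.
rewrite /esq /dotp !mulr_sumr -!big_split; apply: eq_bigr => i _ /=.
by rewrite !mxE; ring.
Qed.

Lemma dotp_line x v (s : R) : dotp (s *: v + x) v = dotp x v + s * esq v.
Proof.
rewrite /esq /dotp mulr_sumr -big_split; apply: eq_bigr => i _ /=.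
by rewrite !mxE; ring.
Qed.

Lemma enormZ (c : R) x : enorm (c *: x) = `|c| * enorm x.
Proof.
rewrite !enorm_esq -sqrtr_sqr -sqrtrM ?sqr_ge0//; congr Num.sqrt.
by rewrite /esq mulr_sumr; apply: eq_bigr => i _; rewrite mxE exprMn.
Qed.

Lemma enorm_sqr x : enorm x ^+ 2 = esq x.
Proof. by rewrite enorm_esq sqr_sqrtr ?esq_ge0. Qed.

Lemma enorm_ge0 x : 0 <= enorm x. Proof. exact: sqrtr_ge0. Qed.

Lemma coord_le_enorm x i : `|x ord0 i| <= enorm x.
Proof.
rewrite -sqrtr_sqr enorm_esq ler_sqrt ?esq_ge0// /esq (bigD1 i)//= lerDl.
by apply: sumr_ge0 => j _; exact: sqr_ge0.
Qed.

(** All differentiation is thereby done by the one-variable chain rule along lines. *)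
Lemma is_derive_line (u : rV -> R) x v (l : R) :
  is_derive (0 : R) 1 (fun h : R => u (h *: v + x)) l -> is_derive x v u l.
Proof.
move=> [du ul]; split; first exact/derivable1P.
rewrite -ul /derive.
set g1 := fun h => h^-1 *: _; set g2 := fun h => h^-1 *: _.
suff -> : g1 = g2 by [].
by apply/funext => h; rewrite /g1 /g2/= addr0 scale0r add0r [_%:A]mulr1.
Qed.

(** Boundedness is included because it makes the notion stable under products; the constant is
    common to all indices so that it serves every coordinate of a gradient. *)
Definition unif_lip (I : Type) (f : I -> rV -> R) := exists M : R,
  [/\ 0 <= M, forall i x, `|f i x| <= M &
      forall i x y, `|f i x - f i y| <= M * enorm (x - y)].

Lemma unif_lipM I (f g : I -> rV -> R) :
  unif_lip f -> unif_lip g -> unif_lip (fun i x => f i x * g i x).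
Proof.
move=> [M [M0 fM fL]] [N [N0 gN gL]]; exists (2 * (M * N)).
split; first by rewrite !mulr_ge0.
  move=> i x; rewrite normrM; apply: (@le_trans _ _ (M * N)).
    by apply: ler_pM.
  by rewrite ler_peMl ?mulr_ge0// ler1n.
move=> i x y.
rewrite (_ : _ - _ = f i x * (g i x - g i y) + (f i x - f i y) * g i y); last by ring.
apply: le_trans (ler_normD _ _) _; rewrite !normrM.
rewrite (_ : 2 * (M * N) * _ = M * (N * enorm (x - y)) + (M * enorm (x - y)) * N);
  last by ring.
by apply: lerD; apply: ler_pM.
Qed.

(** A coordinatewise bound in place of Cauchy-Schwarz, at the price of the factor [n]. *)
Lemma dotp_bound (f : 'I_n -> R) v (M : R) : 0 <= M ->
  (forall i, `|f i| <= M) ->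
  `|\sum_(i < n) f i * v ord0 i| <= n%:R * M * enorm v.
Proof.
move=> M0 fM; apply: le_trans (ler_norm_sum _ _ _) _.
apply: (@le_trans _ _ (\sum_(i < n) M * enorm v)).
  by apply: ler_sum => i _; rewrite normrM; apply: ler_pM => //; exact: coord_le_enorm.
by rewrite sumr_const card_ord -mulrA mulr_natl.
Qed.

Lemma unif_lip_coord :
  unif_lip (fun (i : 'I_n) x => x ord0 i / (1 + esq x)).
Proof.
have p1 x : 0 < 1 + esq x by rewrite (lt_le_trans ltr01)// lerDl esq_ge0.
have e1 x : enorm x <= 1 + esq x.
  rewrite -enorm_sqr -subr_ge0.
  have -> : 1 + enorm x ^+ 2 - enorm x = (enorm x - 2^-1) ^+ 2 + 3 / 4 by field.
  by rewrite addr_ge0 ?sqr_ge0// divr_ge0.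
have e2 x : enorm x / (1 + esq x) <= 1 by rewrite ler_pdivrMr// mul1r.
have i1 x : (1 + esq x)^-1 <= 1 by rewrite invf_le1// lerDl esq_ge0.
have i0 x : 0 <= (1 + esq x)^-1 by rewrite invr_ge0 ltW.
(* In the Lipschitz bound, 1 accounts for the change of the numerator and [2 * n] for that of the
   denominator, through [|esq y - esq x| <= n (|x| + |y|) |x - y|]. *)
exists (1 + 2 * n%:R); split.
- by rewrite addr_ge0// mulr_ge0.
- move=> i x; rewrite normrM [X in _ * X]ger0_norm//.
  apply: (@le_trans _ _ 1); last by rewrite lerDl mulr_ge0.
  by apply: le_trans (e2 x); rewrite ler_wpM2r// coord_le_enorm.
- move=> i x y.
  have -> : x ord0 i / (1 + esq x) - y ord0 i / (1 + esq y) =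
      (x - y) ord0 i / (1 + esq x) +
      y ord0 i / (1 + esq y) * ((esq y - esq x) / (1 + esq x)).
    by rewrite rVBE; field; rewrite !gt_eqF.
  apply: le_trans (ler_normD _ _) _; rewrite [leRHS]mulrDl mul1r; apply: lerD.
    rewrite normrM [X in _ * X]ger0_norm//.
    apply: (@le_trans _ _ (enorm (x - y) * 1)); last by rewrite mulr1.
    by apply: ler_pM => //; exact: coord_le_enorm.
  rewrite normrM.
  have exy : esq y - esq x = \sum_(j < n) (- (x ord0 j + y ord0 j)) * (x - y) ord0 j.
    rewrite /esq -sumrB; apply: eq_bigr => j _; rewrite rVBE; ring.
  have exyB : `|esq y - esq x| <= n%:R * (enorm x + enorm y) * enorm (x - y).
    rewrite exy; apply: (dotp_bound (f := fun j => - (x ord0 j + y ord0 j))).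
      by rewrite addr_ge0 ?enorm_ge0.
    by move=> j; rewrite normrN (le_trans (ler_normD _ _))// lerD// coord_le_enorm.
  have yB : `|y ord0 i / (1 + esq y)| <= enorm y / (1 + esq y).
    by rewrite normrM [X in _ * X]ger0_norm// ler_wpM2r// coord_le_enorm.
  rewrite [X in _ * X]normrM [X in _ * (_ * X)]ger0_norm//.
  apply: (@le_trans _ _ (enorm y / (1 + esq y) *
    (n%:R * (enorm x + enorm y) * enorm (x - y) / (1 + esq x)))).
    apply: ler_pM => //; first by rewrite mulr_ge0.
    by rewrite ler_wpM2r.
  have y2 : enorm y ^+ 2 / (1 + esq y) <= 1.
    by rewrite enorm_sqr ler_pdivrMr// mul1r lerDr.
  have exp : enorm y / (1 + esq y) * (enorm x / (1 + esq x)) <= 1.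
    rewrite -[leRHS]mulr1; apply: ler_pM => //.
      by rewrite mulr_ge0 ?enorm_ge0.
    by rewrite mulr_ge0 ?enorm_ge0.
  have eyp : enorm y ^+ 2 / (1 + esq y) / (1 + esq x) <= 1.
    rewrite -[leRHS]mulr1; apply: ler_pM => //.
    by rewrite mulr_ge0 ?sqr_ge0.
  rewrite [leLHS](_ : _ = (enorm y / (1 + esq y) * (enorm x / (1 + esq x)) +
    enorm y ^+ 2 / (1 + esq y) / (1 + esq x)) * (n%:R * enorm (x - y))); last first.
    by field; rewrite !gt_eqF.
  rewrite -[leRHS]mulrA ler_wpM2r ?mulr_ge0 ?enorm_ge0//.
  by rewrite (_ : 2 = 1 + 1)//; apply: lerD.
Qed.

End directional_derivative.

(** * Functions of the bubble *)

(** Applied to mean-value points on the two halves of the segment from [x + x - y] to [y]. *)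
Lemma dist_segments_le2 (R : realType) (c1 c2 : R) :
  0 <= c1 -> c1 <= 1 -> -1 <= c2 -> c2 <= 0 -> `|c1 - c2| <= 2.
Proof. by move=> *; rewrite ler_norml; apply/andP; split; lra. Qed.

Section profile.
Context {R : realType} (n : nat) (a : R).
Hypotheses (an : a < n%:R).
Local Notation rV := 'rV[R]_n.
Local Notation q := ((n%:R - a) / 2).
Local Notation w := (@bubble R n a).
Implicit Types (x y z v : rV) (s : R).

Let q0 : 0 < q. Proof. by rewrite divr_gt0// subr_gt0. Qed.

Let p1 x : 0 < 1 + esq x.
Proof. by rewrite (lt_le_trans ltr01)// lerDl esq_ge0. Qed.

Lemma bubble_gt0 x : 0 < w x. Proof. by rewrite powR_gt0. Qed.

Lemma bubble_lt x y : (w x < w y) = (esq y < esq x).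
Proof.
rewrite /bubble !powRN ltf_pV2 ?posrE ?powR_gt0//.
apply/idP/idP; last first.
  move=> h; rewrite gt0_ltr_powR// ?nnegrE ?(ltW (p1 _))//.
  by rewrite ltrD2l.
apply: contraTT; rewrite -!leNgt => h; rewrite ge0_ler_powR ?nnegrE ?(ltW (p1 _)) ?(ltW q0)//.
by rewrite lerD2l.
Qed.

Lemma bubble_le1 x : w x <= 1.
Proof.
rewrite /bubble powRN invf_le1 ?powR_gt0//.
apply: (@le_trans _ _ (1 `^ q)); first by rewrite powR1.
by apply: ge0_ler_powR; rewrite ?nnegrE ?(ltW q0) ?(ltW (p1 _))// lerDl esq_ge0.
Qed.

Section composition.
Variables (Phi phi : R -> R).
Hypothesis dPhi : forall s, is_derive s 1 Phi (phi s).

(** The partial derivative of [Phi \o w], with (1 + |x|^2)^(-q-1) written as [w x / (1 + esq x)] so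
    that every factor is bounded and Lipschitz. *)
Definition grad (i : 'I_n) x : R :=
  phi (w x) * ((- (2 * q)) * w x) * (x ord0 i / (1 + esq x)).

Lemma is_derive_profile x v s :
  is_derive s 1 (fun h => Phi (w (h *: v + x)))
    (\sum_(i < n) grad i (s *: v + x) * v ord0 i).
Proof.
(* Along a line, 1 + |.|^2 is a quadratic polynomial in the parameter. *)
pose P h := 1 + (esq x + h * (2 * dotp x v) + h ^+ 2 * esq v).
have PE h : P h = 1 + esq (h *: v + x) by rewrite esq_line.
have P0 : 0 < P s by rewrite PE.
have dP : is_derive s 1 P (2 * (dotp x v + s * esq v)).
  by apply: is_derive_eq; rewrite /GRing.scale/=; ring.
have dw : is_derive (P s) 1 (fun t => t `^ (- q)) (- q * P s `^ (- q - 1)).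
  exact: is_derive1_powR.
have dwP := @is_derive1_comp _ (fun t => t `^ (- q)) P _ _ _ dw dP.
have := @is_derive1_comp _ Phi ((fun t => t `^ (- q)) \o P) _ _ _ (dPhi _) dwP.
rewrite (_ : _ \o _ = (fun h => Phi (w (h *: v + x)))); last first.
  by apply/funext => h; rewrite /= PE.
rewrite (_ : phi _ * _ = \sum_(i < n) grad i (s *: v + x) * v ord0 i)//.
have -> : \sum_(i < n) grad i (s *: v + x) * v ord0 i =
    phi (w (s *: v + x)) * (- (2 * q) * w (s *: v + x)) /
      (1 + esq (s *: v + x)) * dotp (s *: v + x) v.
  by rewrite /dotp mulr_sumr; apply: eq_bigr => i _; rewrite /grad; ring.
rewrite /= PE -/(w (s *: v + x)) dotp_line.
have -> : (1 + esq (s *: v + x)) `^ (- q - 1) = w (s *: v + x) / (1 + esq (s *: v + x)).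
  rewrite /bubble (powR_succ (- q) (p1 _)); field.
  by rewrite gt_eqF.
by ring.
Qed.

Lemma profile_MVT x v (s t : R) : s < t -> exists2 c, s <= c <= t &
  Phi (w (t *: v + x)) - Phi (w (s *: v + x)) =
  (\sum_(i < n) grad i (c *: v + x) * v ord0 i) * (t - s).
Proof.
move=> st.
have cont : {within `[s, t], continuous (fun h => Phi (w (h *: v + x)))}.
  apply: derivable_within_continuous => h _.
  by have [] := is_derive_profile x v h.
have [c] := MVT st (fun h _ => is_derive_profile x v h) cont.
by rewrite in_itv/= => /andP[/ltW sc /ltW ct] E; exists c => //; rewrite sc.
Qed.

Lemma profile_lip (M : R) : 0 <= M -> (forall i x, `|grad i x| <= M) ->
  forall x y, `|Phi (w x) - Phi (w y)| <= n%:R * M * enorm (x - y).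
Proof.
move=> M0 gM x y.
have [c _] := @profile_MVT y (x - y) 0 1 ltr01.
rewrite scale1r subrK scale0r add0r subr0 mulr1 => ->.
exact: dotp_bound.
Qed.

End composition.

Lemma unif_lip_bubble I : unif_lip (fun (_ : I) x => w x).
Proof.
have did (s : R) : is_derive s 1 (@id R) ((fun=> 1) s) by exact: is_derive_id.
have [M [M0 Mb _]] := @unif_lip_coord R n.
have q2 : 0 <= 2 * q by rewrite mulr_ge0// ltW.
have gM i x : `|grad (fun=> 1) i x| <= 2 * q * M.
  rewrite /grad mul1r normrM; apply: ler_pM => //.
  rewrite normrM normrN (ger0_norm q2) (ger0_norm (bubble_ge0 _ _)).
  by rewrite ler_piMr ?bubble_le1.
have qM : 0 <= 2 * q * M by rewrite mulr_ge0.
exists (1 + n%:R * (2 * q * M)); split.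
- by rewrite addr_ge0// mulr_ge0.
- move=> _ x; rewrite ger0_norm ?bubble_ge0//; apply: le_trans (bubble_le1 x) _.
  by rewrite lerDl mulr_ge0.
- move=> _ x y; apply: le_trans (profile_lip did qM gM x y) _.
  by rewrite ler_wpM2r ?enorm_ge0// lerDr.
Qed.

Section composition_estimates.
Variables (Phi phi : R -> R) (L : R).
Hypothesis dPhi : forall s, is_derive s 1 Phi (phi s).
Hypothesis L0 : 0 <= L.
Hypothesis phiL : forall s t, `|phi s - phi t| <= L * `|s - t|.

(** The values of [w] lie in [0, 1], where the Lipschitz function [phi] is bounded; the rest is a
    product of bounded Lipschitz factors. *)
Lemma unif_lip_grad : unif_lip (grad phi).
Proof.
have [M [M0 Mb ML]] := unif_lip_bubble 'I_n.
have lphi : unif_lip (fun (_ : 'I_n) x => phi (w x)).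
  exists (`|phi 0| + L + L * M); split.
  - by rewrite !addr_ge0// mulr_ge0.
  - move=> _ x; rewrite -[X in `|X|](subrK (phi 0)) addrC.
    apply: le_trans (ler_normD _ _) _; rewrite -addrA lerD2l.
    apply: le_trans (phiL _ _) _; rewrite subr0.
    apply: (@le_trans _ _ L); last by rewrite lerDl mulr_ge0.
    by rewrite ler_piMr// ger0_norm ?bubble_ge0 ?bubble_le1.
  - move=> i x y; apply: le_trans (phiL _ _) _.
    apply: (@le_trans _ _ (L * (M * enorm (x - y)))); first by rewrite ler_wpM2l// (ML i).
    by rewrite mulrA ler_wpM2r ?enorm_ge0// lerDr addr_ge0.
have lcst : unif_lip (fun (_ : 'I_n) (_ : rV) => - (2 * q)).
  exists `|- (2 * q)|; split => // i x y; rewrite subrr normr0.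
  by rewrite mulr_ge0 ?enorm_ge0.
exact: (unif_lipM (unif_lipM lphi (unif_lipM lcst (unif_lip_bubble 'I_n)))
  (@unif_lip_coord R n)).
Qed.

(** [k] will be the integer part of [alpha], which is 0 or 1. A Lipschitz gradient gives the largest
    admissible Hoelder exponent, 1. *)
Lemma profile_hoelder (k : nat) : (k <= 1)%N ->
  hoelder_loc k 1 (fun x => Phi (w x)).
Proof.
have [M [M0 Mb ML]] := unif_lip_grad.
case: k => [_ K _|[_|//]].
  exists (n%:R * M) => x y _ _; rewrite powRr1 ?enorm_ge0//.
  exact: (profile_lip dPhi).
move=> i.
have dE x : is_derive x (delta_mx ord0 i : rV) (fun x => Phi (w x)) (grad phi i x).
  apply: is_derive_line; have := is_derive_profile dPhi x (delta_mx ord0 i) 0.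
  rewrite scale0r add0r (bigD1 i)//= mxE !eqxx mulr1 big1 ?addr0// => j ji.
  by rewrite mxE (negbTE ji) andbF mulr0.
split; first by move=> x; have [] := dE x.
rewrite (_ : 'D_(delta_mx ord0 i) _ = grad phi i); last first.
  by apply/funext => x; have [] := dE x.
move=> K _; exists M => x y _ _; rewrite powRr1 ?enorm_ge0//.
Qed.

Lemma profile_symdiff (B : R) : (forall x, `|Phi (w x)| <= B) ->
  exists C : R, forall x y,
    `|symdiff (fun x => Phi (w x)) x y| <= C * bump (y - x).
Proof.
move=> uB; have [M [M0 Mb ML]] := unif_lip_grad.
(* [4 * B] bounds the four values of the profile; [2 * (n * M)] is the near bound, whose 2 is the
   largest distance between mean-value parameters. *)
pose C := Num.max (4 * B) (2 * (n%:R * M)).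
have C4 : 4 * B <= C by rewrite le_max lexx.
have C2 : 2 * (n%:R * M) <= C by rewrite le_max lexx orbT.
have C0 : 0 <= C by apply: le_trans C2; rewrite !mulr_ge0.
exists C => x y; set z := y - x.
rewrite /bump minr_pMr// le_min mulr1; apply/andP; split.
  apply: le_trans C4; rewrite /symdiff.
  move: (uB x) (uB y) (uB (x + x - y)); rewrite !ler_norml.
  by move=> /andP[? ?] /andP[? ?] /andP[? ?]; apply/andP; split; lra.
(* The mean value theorem on either side of [x] writes the symmetric difference as a difference of
   gradients, so a Lipschitz bound replaces second derivatives. *)
have [c1 /andP[c10 c11] E1] := profile_MVT dPhi x z (@ltr01 R).
have [c2 /andP[c20 c21] E2] := @profile_MVT _ _ dPhi x z (-1) 0 (ltrN10 R).
have -> : symdiff (fun x => Phi (w x)) x y =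
    - (Phi (w (1 *: z + x)) - Phi (w (0 *: z + x)) -
       (Phi (w (0 *: z + x)) - Phi (w (-1 *: z + x)))).
  rewrite /symdiff !scale1r scale0r add0r scaleN1r.
  rewrite (_ : z + x = y) ?subrK// (_ : - z + x = x + x - y); last first.
    by rewrite /z opprB addrAC addrC addrA.
  ring.
rewrite normrN E1 E2 subr0 sub0r opprK !mulr1 -sumrB.
rewrite (eq_bigr (fun i => (grad phi i (c1 *: z + x) - grad phi i (c2 *: z + x)) * z ord0 i));
  last by move=> i _; rewrite mulrBl.
apply: (@le_trans _ _ (n%:R * (M * (2 * enorm z)) * enorm z)).
  apply: dotp_bound; first by rewrite !mulr_ge0 ?enorm_ge0.
  move=> i; apply: le_trans (ML i _ _) _; rewrite ler_wpM2l//.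
  rewrite opprD addrACA subrr addr0 -scalerBl enormZ ler_wpM2r ?enorm_ge0//.
  exact: dist_segments_le2.
rewrite -enorm_sqr (_ : _ * _ = 2 * (n%:R * M) * enorm z ^+ 2); last by ring.
by rewrite ler_wpM2r ?sqr_ge0.
Qed.

End composition_estimates.

End profile.

(** * Mass of the kernel far away *)

Section far_mass.
Context {R : realType} (n : nat) (a : R).
Hypotheses (n1 : (1 <= n)%N) (a0 : 0 < a) (a2 : a < 2) (an : a < n%:R).
Local Notation leb := (@lebesgue_rV R n).
Local Notation rV := 'rV[R]_n.
Local Notation Q := ((n%:R + a) / 2).
Local Notation S := (Num.sqrt pi ^+ n).
Implicit Types (x y z : rV).

Let Q0 : 0 < Q. Proof. by rewrite divr_gt0// addr_gt0// (lt_trans a0). Qed.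

Let mcenter x : measurable_fun setT (fun y : rV => y - x).
Proof. exact: measurable_rVB. Qed.

Let mgauss (t : R) x : measurable_fun setT (fun y : rV => (expR (- (t * esq (y - x))))%:E).
Proof.
apply/measurable_EFinP; apply: measurableT_comp => //; apply: measurableT_comp => //.
by apply: measurable_funM => //; exact: measurable_esq.
Qed.

(** After taking roots of order [Q], this is [v <= exp v] at [v = esq z / (Q * t)]. *)
Lemma expR_le_riesz t z : 0 < t -> 0 < esq z ->
  expR (- (t^-1 * esq z)) <= (Q * t) `^ Q * riesz a z.
Proof.
move=> t0 z0.
rewrite /riesz gt0_ppow// expRN powRN ler_pdivlMr ?powR_gt0// ler_pdivrMl ?expR_gt0//.
rewrite [leRHS]mulrC.
have Qt : 0 < Q * t by rewrite mulr_gt0.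
have -> : expR (t^-1 * esq z) = expR (esq z / (Q * t)) `^ Q.
  by rewrite -expRM; congr expR; field; rewrite !gt_eqF// addr_gt0// (lt_trans a0).
rewrite -powRM ?expR_ge0 ?(ltW Qt)//.
apply: ge0_ler_powR; first exact: ltW.
- by rewrite nnegrE ltW.
- by rewrite nnegrE mulr_ge0 ?expR_ge0// ltW.
rewrite -ler_pdivrMl// [_^-1 * _]mulrC.
by rewrite (le_trans _ (expR_ge1Dx _))// lerDr.
Qed.

(** Two Gaussians are compared, which avoids polar coordinates. The one at time [t] has mass
    [S * (e + 1)]. On the ball of radius [r] it is at most 1, hence at most [e] times the one at
    time 1, whose total is [e * S]. A mass of at least [S] is thus left outside the ball, where the
    Gaussian is at most [K] times the kernel. *)
Lemma integral_far_riesz_gt0 (r : R) : 0 < r -> exists2 c : R, 0 < c &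
  forall x, (c%:E <= \int[leb]_y (far r x y * riesz a (y - x))%:E)%E.
Proof.
move=> r0; set e := expR (r ^+ 2).
have e0 : 0 < e by exact: expR_gt0.
have n0 : n%:R != 0 :> R by rewrite pnatr_eq0 -lt0n.
(* Chosen so that [t ^ (n / 2) = e + 1]; this is where [n] has to be nonzero. *)
pose t := (e + 1) `^ (2 / n%:R).
have t0 : 0 < t by rewrite powR_gt0// addr_gt0.
have tE : t `^ (n%:R / 2) = e + 1.
  rewrite /t -powRrM (_ : 2 / n%:R * (n%:R / 2) = 1); last by field.
  by rewrite powRr1// addr_ge0// ltW.
pose K := (Q * t) `^ Q.
have K0 : 0 < K by rewrite powR_gt0// mulr_gt0.
have S0 : 0 < S :> R by rewrite exprn_gt0// sqrtr_gt0 pi_gt0.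
exists (S / K); first by rewrite divr_gt0.
move=> x.
set I := (\int[leb]_y _)%E.
have mfr : measurable_fun setT (fun y => far r x y * riesz a (y - x)).
  by apply: measurable_funM; [exact: measurable_far|exact: measurable_riesz].
have fr0 y : 0 <= far r x y * riesz a (y - x) by rewrite mulr_ge0 ?riesz_ge0.
have : ((S * (e + 1))%:E <= (e * S)%:E + K%:E * I)%E.
  rewrite -tE -(integral_gauss_time x t0).
  have -> : ((e * S)%:E = e%:E * \int[leb]_y (expR (- (1^-1 * esq (y - x))))%:E)%E.
    by rewrite integral_gauss_time// powR1 mulr1 -EFinM.
  rewrite /I -!ge0_integralZl_EFin ?(ltW e0) ?(ltW K0)//;
    do ?[exact: mgauss|exact/measurable_EFinP|by move=> y _; rewrite lee_fin].
  rewrite -ge0_integralD//; last 4 first.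
  - by move=> y _; rewrite mule_ge0 ?lee_fin ?expR_ge0 ?(ltW e0).
  - by apply: measurable_funeM; exact: mgauss.
  - by move=> y _; rewrite mule_ge0 ?lee_fin ?(ltW K0).
  - by apply: measurable_funeM; exact/measurable_EFinP.
  apply: ge0_le_integral => //.
    apply: emeasurable_funD; first by apply: measurable_funeM; exact: mgauss.
    by apply: measurable_funeM; exact/measurable_EFinP.
  move=> y _; rewrite -!EFinM -EFinD lee_fin invr1 mul1r.
  have z0 := esq_ge0 (y - x).
  have [h|h] := leP r (enorm (y - x)).
    rewrite /far h mul1r.
    have zp : 0 < esq (y - x) by rewrite -enorm_sqr exprn_gt0// (lt_le_trans r0).
    apply: le_trans (expR_le_riesz t0 zp) _.
    by rewrite lerDr mulr_ge0 ?expR_ge0// ltW.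
  apply: (@le_trans _ _ 1).
    by rewrite -expR0 ler_expR oppr_le0 mulr_ge0// invr_ge0 ltW.
  apply: (@le_trans _ _ (e * expR (- esq (y - x)))); last first.
    by rewrite lerDl mulr_ge0// ltW.
  rewrite /e -expRD -expR0 ler_expR subr_ge0 -enorm_sqr ler_sqr ?nnegrE ?enorm_ge0//.
    exact: ltW.
  exact: ltW.
have I0 : (0 <= I)%E by apply: integral_ge0 => y _; rewrite lee_fin.
clearbody I; case: I I0 => [v| |] I0 h; [|exact: leey|by []].
move: h; rewrite !lee_fin => h; rewrite ler_pdivrMr// mulrC.
by move: h; rewrite mulrDr mulr1 [e * S]mulrC lerD2l.
Qed.

Lemma measurable_weight :
  measurable_fun setT (fun y : rV => (1 + enorm y `^ (n%:R + a))^-1).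
Proof.
rewrite (_ : (fun _ => _) = (fun y : rV => (1 + (esq y) `^ Q) `^ (-1))); last first.
  apply/funext => y; rewrite powR_inv1 ?addr_ge0 ?powR_ge0//.
  rewrite enorm_esq -powR12_sqrt ?esq_ge0// -powRrM.
  by congr ((1 + _ `^ _)^-1); ring.
apply: (measurableT_comp (measurable_powR _)); apply: measurable_funD => //.
by apply: (measurableT_comp (measurable_powR _)); exact: measurable_esq.
Qed.

(** The weight is at most the kernel where |y| >= 1, and at most [exp (1 - |y|^2)] inside the unit
    ball. It follows that bounded measurable functions lie in the weighted space. *)
Lemma integral_weight_lty :
  (\int[leb]_y (1 / (1 + enorm y `^ (n%:R + a)))%:E < +oo)%E.
Proof.
have [M M0 HM] := @integral_bump_riesz_lty R n a a0 a2 an.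
have mbr : measurable_fun setT (fun y : rV => bump (y - 0) * riesz a (y - 0)).
  by apply: measurable_funM; [exact: measurable_bump|exact: measurable_riesz].
have br0 y : 0 <= bump (y - 0) * riesz a (y - 0).
  by rewrite mulr_ge0 ?bump_ge0 ?riesz_ge0.
have e0 := expR_gt0 (1 : R).
have fin1 : (\int[leb]_y (bump (y - 0) * riesz a (y - 0))%:E +
    (expR 1)%:E * \int[leb]_y (expR (- (1^-1 * esq (y - 0))))%:E < +oo)%E.
  rewrite integral_gauss_time// -EFinM lte_add_pinfty ?ltry//.
  exact: (le_lt_trans (HM 0) (ltry _)).
apply: le_lt_trans fin1.
rewrite -ge0_integralZl_EFin ?(ltW e0)//.
rewrite -ge0_integralD//; do ?[exact/measurable_EFinP
  |by apply: measurable_funeM; exact: mgauss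
  |by move=> y _; rewrite ?mule_ge0 ?lee_fin ?expR_ge0].
have E0 y : 0 <= enorm y `^ (n%:R + a) by exact: powR_ge0.
apply: ge0_le_integral => //.
- by move=> y _; rewrite lee_fin divr_ge0// addr_ge0.
- apply/measurable_EFinP; apply: measurable_funM => //.
  exact: measurable_weight.
- apply: emeasurable_funD; first exact/measurable_EFinP.
  by apply: measurable_funeM; exact: mgauss.
move=> y _; rewrite -EFinM -EFinD lee_fin subr0 invr1 !mul1r.
have [h|h] := leP 1 (esq y).
  apply: (@le_trans _ _ (bump y * riesz a y)); last by rewrite lerDl mulr_ge0 ?expR_ge0.
  rewrite /bump min_l// mul1r -enorm_riesz// lef_pV2 ?posrE.
  - by rewrite lerDr.
  - by rewrite ltr_wpDr.
  - rewrite powR_gt0// enorm_esq sqrtr_gt0; exact: lt_le_trans h.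
apply: (@le_trans _ _ 1); first by rewrite invf_le1 ?lerDl// ltr_wpDr.
apply: (@le_trans _ _ (expR 1 * expR (- esq y))).
  by rewrite -expRD -[leLHS]expR0 ler_expR subr_ge0 ltW.
by rewrite lerDr mulr_ge0 ?bump_ge0 ?riesz_ge0.
Qed.

End far_mass.

(** * Calculus of the square of the positive part *)

Section squared_positive_part.
Context {R : realType}.
Implicit Types s t : R.

Definition sqp t : R := Num.max t 0 ^+ 2.

Lemma sqp_ge0 t : 0 <= sqp t. Proof. exact: sqr_ge0. Qed.

Lemma sqp_eq0 t : t <= 0 -> sqp t = 0.
Proof. by move=> t0; rewrite /sqp max_r// expr0n. Qed.

Lemma sqp_sqr t : 0 <= t -> sqp t = t ^+ 2.
Proof. by move=> t0; rewrite /sqp max_l. Qed.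

(** A quadratic remainder in all four sign cases, so the point 0, where the formula changes, needs
    no separate treatment in the derivative. *)
Lemma sqp_expansion t s :
  `|sqp s - sqp t - 2 * Num.max t 0 * (s - t)| <= (s - t) ^+ 2.
Proof.
have d0 := sqr_ge0 (s - t); have s2 := sqr_ge0 s; have t2 := sqr_ge0 t.
rewrite /sqp ler_norml; have [t0|t0] := leP t 0; have [s0|s0] := leP s 0.
- by apply/andP; split; lra.
- have st : s * t <= 0 by rewrite pmulr_rle0.
  by apply/andP; split; rewrite ?(sqrrB s t) ?expr0n/= in d0 *; lra.
- have st : t * s <= 0 by rewrite pmulr_rle0.
  by apply/andP; split; rewrite ?(sqrrB s t) ?expr0n/= in d0 *; lra.
- by apply/andP; split; rewrite ?(sqrrB s t) in d0 *; lra.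
Qed.

Lemma is_derive_sqp t : is_derive t 1 sqp (2 * Num.max t 0).
Proof.
have cvgD : (fun h : R => h^-1 *: ((sqp \o shift t) (h *: (1 : R)) - sqp t))
    @ 0^' --> 2 * Num.max t 0.
  apply/cvgrPdist_le => e e0; near=> h.
  have h0 : h != 0 by near: h; exact: nbhs_dnbhs_neq.
  have he : `|h| <= e.
    near: h; apply: dnbhs0_le; exact: e0.
  rewrite /= /GRing.scale/= mulr1.
  have := sqp_expansion t (h + t); rewrite addrK => H.
  rewrite distrC -(ler_pM2l (x := `|h|)) ?normr_gt0// -normrM mulrBr.
  have -> : h * (h^-1 * (sqp (h + t) - sqp t)) - h * (2 * Num.max t 0) =
      sqp (h + t) - sqp t - 2 * Num.max t 0 * h by field.
  apply: le_trans H _.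
  by rewrite -[h ^+ 2]ger0_norm ?sqr_ge0// normrX expr2 ler_wpM2l.
split; first by apply/cvg_ex; eexists; exact: cvgD.
exact: cvg_lim cvgD.
Unshelve. all: by end_near. Qed.

Lemma max0_lip s t : `|Num.max s 0 - Num.max t 0| <= `|s - t|.
Proof.
have h1 := ler_norm (s - t); have h2 := ler_norm (t - s).
rewrite distrC in h2; have h3 := normr_ge0 (s - t).
rewrite ler_norml; have [s0|s0] := leP s 0; have [t0|t0] := leP t 0;
  apply/andP; split; lra.
Qed.

End squared_positive_part.

(** * The function u *)

Section counterexample.
Context {R : realType} (n : nat) (a : R).
Hypotheses (n1 : (1 <= n)%N) (a0 : 0 < a) (a2 : a < 2) (an : a < n%:R).
Local Notation leb := (@lebesgue_rV R n).
Local Notation rV := 'rV[R]_n.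
Local Notation q := ((n%:R - a) / 2).
Local Notation w := (@bubble R n a).
Implicit Types (x y z : rV) (s t e : R).

Let q0 : 0 < q. Proof. by rewrite divr_gt0// subr_gt0. Qed.

(* The value of the bubble on the unit sphere. *)
Definition level : R := 2 `^ (- q).

Let level0 : 0 < level. Proof. exact: powR_gt0. Qed.

Let powN_lt1 (c : R) : 1 < c -> c `^ (- q) < 1.
Proof.
move=> c1; rewrite powRN invf_lt1 ?powR_gt0 ?(lt_trans ltr01)//.
apply: (@le_lt_trans _ _ (1 `^ q)); first by rewrite powR1.
by rewrite gt0_ltr_powR ?nnegrE// ltW// (lt_trans ltr01).
Qed.

Let level1 : level < 1. Proof. by apply: powN_lt1; rewrite ltr1n. Qed.

Lemma level_lt_bubble x : (level < w x) = (esq x < 1).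
Proof.
have pp : 0 < 1 + esq x by rewrite (lt_le_trans ltr01)// lerDl esq_ge0.
rewrite /level /bubble !powRN ltf_pV2 ?posrE ?powR_gt0//.
apply/idP/idP; last first.
  by move=> h; rewrite gt0_ltr_powR ?nnegrE ?(ltW pp)//; lra.
apply: contraTT; rewrite -!leNgt => h.
by rewrite ge0_ler_powR ?nnegrE ?(ltW pp) ?(ltW q0)//; lra.
Qed.

(** On the range of the bubble both squares are at most 1, so the constant 3 keeps the profile at
    least 1 when [0 <= e <= 1]. *)
Definition prof e t : R := 3 - sqp (level - t) - e * sqp (t - level).

Definition prof' e t : R :=
  2 * Num.max (level - t) 0 - e * (2 * Num.max (t - level) 0).

Lemma is_derive_prof e t : is_derive t 1 (prof e) (prof' e t).
Proof.
have d1 : is_derive t 1 (fun t => level - t) (- 1) by apply: is_derive_eq; ring.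
have d2 : is_derive t 1 (fun t => t - level) (1 : R).
  by apply: is_derive_eq; ring.
have D1 := @is_derive1_comp _ sqp (fun t => level - t) _ _ _
  (is_derive_sqp (level - t)) d1.
have D2 := @is_derive1_comp _ sqp (fun t => t - level) _ _ _
  (is_derive_sqp (t - level)) d2.
rewrite (_ : prof e = (cst 3 - sqp \o (fun t => level - t)) -
  e \*: (sqp \o (fun t => t - level))); last first.
  by apply/funext => s.
apply: is_derive_eq; rewrite /prof' /GRing.scale/=; ring.
Qed.

Lemma prof'_lip e s t : 0 <= e <= 1 ->
  `|prof' e s - prof' e t| <= 4 * `|s - t|.
Proof.
move=> /andP[e0 e1].
have h1 := max0_lip (level - s) (level - t).
have h2 := max0_lip (s - level) (t - level).
rewrite (_ : level - s - (level - t) = - (s - t)) ?normrN in h1; last by ring.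
rewrite (_ : s - level - (t - level) = s - t) in h2; last by ring.
rewrite /prof' (_ : _ - _ = 2 * (Num.max (level - s) 0 - Num.max (level - t) 0) -
  e * (2 * (Num.max (s - level) 0 - Num.max (t - level) 0))); last by ring.
apply: le_trans (ler_normB _ _) _; rewrite !normrM (ger0_norm e0) ger0_norm//.
rewrite (_ : 4 * _ = 2 * `|s - t| + 1 * (2 * `|s - t|)); last by ring.
apply: lerD; first by rewrite ler_pM2l.
by apply: ler_pM => //; rewrite ?mulr_ge0// ler_pM2l.
Qed.

Lemma sqp_le1 t : t <= 1 -> sqp t <= 1.
Proof.
move=> t1; rewrite /sqp -[leRHS](expr1n _ 2) ler_sqr ?nnegrE//.
  by rewrite ge_max t1 ler01.
by rewrite le_max lexx orbT.
Qed.

Lemma prof_bubble_bounds e x : 0 <= e <= 1 -> 1 <= prof e (w x) <= 3.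
Proof.
move=> /andP[e0 e1]; have w0 := bubble_gt0 a x; have w1 := bubble_le1 an x.
have s1 : sqp (level - w x) <= 1 by apply: sqp_le1; move: level1; lra.
have s2 : sqp (w x - level) <= 1 by apply: sqp_le1; move: level0; lra.
have s3 := sqp_ge0 (level - w x); have s4 := sqp_ge0 (w x - level).
have s5 : e * sqp (w x - level) <= 1.
  by rewrite -[leRHS]mulr1; apply: ler_pM.
have s6 : 0 <= e * sqp (w x - level) by exact: mulr_ge0.
by rewrite /prof; apply/andP; split; lra.
Qed.

Lemma prof_bubble_norm e x : 0 <= e <= 1 -> `|prof e (w x)| <= 3.
Proof.
move=> e01; have /andP[h1 h2] := prof_bubble_bounds x e01.
by rewrite ger0_norm// (le_trans ler01).
Qed.

Lemma measurable_prof_bubble e : measurable_fun setT (fun x : rV => prof e (w x)).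
Proof.
apply: (@measurableT_comp _ _ _ _ _ _ (prof e)); last exact: measurable_bubble.
apply: continuous_measurable_fun => t.
apply: differentiable_continuous; apply/derivable1_diffP.
by have [] := is_derive_prof e t.
Qed.

Lemma prof_symdiff e : 0 <= e <= 1 -> exists C : R, forall x y,
  `|symdiff (fun x => prof e (w x)) x y| <= C * bump (y - x).
Proof.
move=> e01.
have L0 : 0 <= 4 :> R by [].
exact: (profile_symdiff an (is_derive_prof e) L0
  (fun s t => prof'_lip s t e01) (fun x => prof_bubble_norm x e01)).
Qed.

Lemma bubble_symdiff : exists C : R, forall x y,
  `|symdiff w x y| <= C * bump (y - x).
Proof.
have did s : is_derive s 1 (@id R) ((fun=> 1) s) by exact: is_derive_id.
have L0 : 0 <= 0 :> R by [].
apply: (@profile_symdiff R n a an id (fun=> 1) 0 did L0 _ 1).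
  by move=> s t; rewrite subrr normr0 mul0r.
by move=> x; rewrite ger0_norm ?bubble_ge0 ?bubble_le1.
Qed.

(* Outside the unit ball [prof e] lies below its tangent at [w x]. *)
Lemma prof_tangent e s t : 0 <= e -> s <= level ->
  prof e t <= prof e s + 2 * (level - s) * (t - s).
Proof.
move=> e0 sl; rewrite /prof (@sqp_eq0 _ (s - level)) ?subr_le0// mulr0 subr0.
rewrite (@sqp_sqr _ (level - s)) ?subr_ge0//.
have h := mulr_ge0 e0 (sqp_ge0 (t - level)).
suff : (level - s) ^+ 2 - 2 * (level - s) * (t - s) <= sqp (level - t) by lra.
have [lt|lt] := leP t level.
  rewrite sqp_sqr ?subr_ge0// -subr_ge0.
  by rewrite (_ : _ - _ = (t - s) ^+ 2) ?sqr_ge0//; ring.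
rewrite (@sqp_eq0 _ (level - t)); last by rewrite subr_le0 ltW.
have -> : (level - s) ^+ 2 - 2 * (level - s) * (t - s) =
    (level - s) * ((level - t) - (t - s)) by ring.
by rewrite mulr_ge0_le0 ?subr_ge0//; lra.
Qed.

Lemma prof_superharmonic_out e x : 0 <= e <= 1 -> 1 <= esq x ->
  (0 <= \int[leb]_y
    (symdiff (fun x => prof e (w x)) x y * riesz a (y - x))%:E)%E.
Proof.
move=> /[dup] e01 /andP[e0 _] x1; have [C HC] := bubble_symdiff.
have [C' HC'] := prof_symdiff e01.
have iw := symdiff_riesz_integrable a0 a2 an (@measurable_bubble R n a) (HC x).
have ip := symdiff_riesz_integrable a0 a2 an (measurable_prof_bubble e) (HC' x).
have wl : w x <= level by rewrite leNgt level_lt_bubble -leNgt.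
(* The slope of [prof e] at [w x]; the tangent bound at [y] and at its reflection shows that the
   symmetric difference of the profile is at least [l] times that of [w]. *)
pose l := 2 * (level - w x).
have l0 : 0 <= l by rewrite mulr_ge0// subr_ge0.
apply: (@le_trans _ _ (\int[leb]_y (l%:E * (symdiff w x y * riesz a (y - x))%:E))%E).
  rewrite integralZl// mule_ge0 ?lee_fin//.
  exact: (bubble_superharmonic a0 a2 an (HC x)).
apply: le_integral => //; first exact: integrableZl.
move=> y _; rewrite -EFinM lee_fin mulrA ler_wpM2r ?riesz_ge0//.
have h1 := prof_tangent (w y) e0 wl.
have h2 := prof_tangent (w (x + x - y)) e0 wl.
rewrite /symdiff -/l in h1 h2 *.
rewrite (_ : l * _ = - (l * (w y - w x)) - l * (w (x + x - y) - w x)); last by ring.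
lra.
Qed.

Lemma prof_superharmonic_in : exists2 e, 0 < e <= 1 & forall x, esq x < 1 ->
  (0 <= \int[leb]_y
    (symdiff (fun x => prof e (w x)) x y * riesz a (y - x))%:E)%E.
Proof.
(* If |x| < 1 and |y - x| >= 4, then |y|^2 >= 16/2 - |x|^2 > 7, so [w y <= 8 ^ (- q)] and [k] is a
   gap below the level. *)
pose k := level - 8 `^ (- q).
have k0 : 0 < k.
  rewrite subr_gt0 /level !powRN ltf_pV2 ?posrE ?powR_gt0//.
  by rewrite gt0_ltr_powR ?nnegrE// ltr_nat.
have [c c0 Hc] := @integral_far_riesz_gt0 R n a n1 a0 an 4 (ltr0n _ _).
have [M M0 HM] := @integral_bump_riesz_lty R n a a0 a2 an.
(* The bound for [sqp (w - level)] comes from [prof 1 - prof 0]. *)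
have [C1 HC1] := @prof_symdiff 1 (introT andP (conj ler01 (lexx 1))).
have [C2 HC2] := @prof_symdiff 0 (introT andP (conj (lexx 0) ler01)).
pose C := `|C1| + `|C2|.
have C0 : 0 <= C by exact: addr_ge0.
(* Makes [e <= 1] and [e * (C * M) <= k ^ 2 * c]: the harm done by the second square is at most the
   far gain. The denominator is positive even when [C = 0]. *)
pose e := k ^+ 2 * c / (k ^+ 2 * c + C * M).
have kc0 : 0 < k ^+ 2 * c by rewrite mulr_gt0// exprn_gt0.
have CM0 : 0 <= C * M by rewrite mulr_ge0// ltW.
have den0 : 0 < k ^+ 2 * c + C * M by rewrite ltr_wpDr.
have e0 : 0 < e by rewrite divr_gt0.
have e1 : e <= 1 by rewrite ler_pdivrMr// mul1r lerDl.
have eCM : e * (C * M) <= k ^+ 2 * c.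
  rewrite /e mulrAC ler_pdivrMr// ler_pM2l// lerDr; exact: ltW.
have e01 : 0 <= e <= 1 by rewrite (ltW e0).
exists e; first by rewrite e0.
move=> x x1; have [C' HC'] := prof_symdiff e01.
have mp := measurable_prof_bubble e.
have ip := symdiff_riesz_integrable a0 a2 an mp (HC' x).
have mr := measurable_riesz a x.
have mb := measurable_bump x.
have iM : leb.-integrable setT (fun y => (bump (y - x) * riesz a (y - x))%:E).
  apply/integrableP; split; first by apply/measurable_EFinP; exact: measurable_funM.
  under eq_integral do rewrite gee0_abs ?lee_fin ?mulr_ge0 ?bump_ge0 ?riesz_ge0//.
  exact: (le_lt_trans (HM x) (ltry _)).
have wl : level < w x by rewrite level_lt_bubble.
(* Since [h x = 0], the symmetric difference of the profile is
   [h y + h (x + x - y) - e * symdiff g x y]. Of the nonnegative terms, only [h y] at points far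
   from [x] is kept. *)
have key y : k ^+ 2 * far 4 x y <=
    symdiff (fun x => prof e (w x)) x y + e * C * bump (y - x).
  have h1 := HC1 x y; have h2 := HC2 x y.
  pose g z := sqp (w z - level).
  pose h z := sqp (level - w z).
  have hx : h x = 0 by rewrite /h sqp_eq0// subr_le0 ltW.
  have pE f z : prof f (w z) = 3 - h z - f * g z by [].
  have sg : symdiff (fun x => prof 1 (w x)) x y - symdiff (fun x => prof 0 (w x)) x y =
      - symdiff g x y.
    by rewrite /symdiff !pE; ring.
  have gB : `|symdiff g x y| <= C * bump (y - x).
    rewrite -normrN -sg; apply: le_trans (ler_normB _ _) _; rewrite /C mulrDl.
    apply: lerD; [apply: le_trans h1 _|apply: le_trans h2 _];
      by rewrite ler_wpM2r ?bump_ge0// ler_norm.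
  have -> : symdiff (fun x => prof e (w x)) x y =
      h y + h (x + x - y) - e * symdiff g x y.
    by rewrite /symdiff !pE hx; ring.
  have gB' : symdiff g x y <= C * bump (y - x) by apply: le_trans gB; exact: ler_norm.
  have gB2 : e * symdiff g x y <= e * C * bump (y - x).
    by rewrite -mulrA ler_pM2l.
  suff : k ^+ 2 * far 4 x y <= h y + h (x + x - y) by lra.
  have hy0 : 0 <= h (x + x - y) by exact: sqp_ge0.
  suff : k ^+ 2 * far 4 x y <= h y by lra.
  rewrite /far; have [f4|_] := leP 4 (enorm (y - x)); last first.
    by rewrite mulr0 sqp_ge0.
  have y7 : 7 <= esq y.
    have : 16 <= esq (y - x).
      rewrite -enorm_sqr (_ : 16 = 4 ^+ 2); last by ring.
      by rewrite ler_sqr ?nnegrE ?enorm_ge0.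
    have : esq (y - x) <= 2 * esq x + 2 * esq y.
      rewrite /esq !mulr_sumr -big_split/=; apply: ler_sum => i _.
      rewrite rVBE -subr_ge0.
      rewrite (_ : _ - _ = (y ord0 i + x ord0 i) ^+ 2) ?sqr_ge0//; ring.
    by move: x1; lra.
  have wy : w y <= 8 `^ (- q).
    rewrite /bubble !powRN lef_pV2 ?posrE ?powR_gt0//; last by lra.
    by rewrite ge0_ler_powR ?nnegrE ?(ltW q0)//; lra.
  have kh : k <= level - w y by rewrite /k; lra.
  rewrite mulr1 /h sqp_sqr; last by rewrite (le_trans (ltW k0)).
  by rewrite ler_sqr ?nnegrE ?(ltW k0)// (le_trans (ltW k0)).
set I := (\int[leb]_y _)%E.
have fI : I \is a fin_num by exact: integrable_fin_num.
have le1 : ((k ^+ 2 * c)%:E <= I + (e * C * M)%:E)%E.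
  apply: (@le_trans _ _ (\int[leb]_y ((k ^+ 2)%:E * (far 4 x y * riesz a (y - x))%:E))%E).
    rewrite ge0_integralZl_EFin ?sqr_ge0//.
    - by rewrite EFinM; apply: lee_wpmul2l; rewrite ?lee_fin ?sqr_ge0.
    - by move=> y _; rewrite lee_fin mulr_ge0 ?riesz_ge0.
    - apply/measurable_EFinP; apply: measurable_funM => //.
      exact: measurable_far.
  apply: (@le_trans _ _ (\int[leb]_y ((symdiff (fun x => prof e (w x)) x y *
      riesz a (y - x))%:E + (e * C)%:E * (bump (y - x) * riesz a (y - x))%:E))%E).
    apply: ge0_le_integral => //.
    - move=> y _; rewrite -EFinM lee_fin mulr_ge0 ?sqr_ge0//.
      by rewrite mulr_ge0 ?riesz_ge0.
    - apply: measurable_funeM; apply/measurable_EFinP; apply: measurable_funM => //.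
      exact: measurable_far.
    - apply: emeasurable_funD; first exact: (measurable_int _ ip).
      by apply: measurable_funeM; exact: (measurable_int _ iM).
    move=> y _; rewrite -!EFinM -EFinD lee_fin !mulrA -mulrDl.
    by rewrite ler_wpM2r ?riesz_ge0.
  rewrite integralD//; last exact: integrableZl.
  rewrite integralZl//; apply: leeD2l; rewrite [leRHS]EFinM.
  by apply: lee_wpmul2l; [rewrite lee_fin mulr_ge0 ?(ltW e0)|exact: HM].
move: le1; rewrite -(fineK fI) -EFinD !lee_fin.
by move: eCM; rewrite -mulrA; lra.
Qed.

End counterexample.

(** Only the sign of the constant enters, and [Gamma] is the integral of a nonnegative function at
    every argument. *)
Lemma frac_laplacian_cst_ge0 (R : realType) (n : nat) (a : R) : 0 <= a ->
  0 <= @frac_laplacian_cst R n a.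
Proof.
move=> a0.
have G0 (z : R) : 0 <= Gamma z.
  by apply: Rintegral_ge0 => t _; rewrite mulr_ge0 ?powR_ge0 ?expR_ge0.
by rewrite /frac_laplacian_cst divr_ge0 ?mulr_ge0 ?powR_ge0.
Qed.

Unset Implicit Arguments.

Theorem proposition1p2 (R : realType) (n : nat) (alpha : R) :
  (1 <= n)%N -> 0 < alpha -> alpha < Num.min 2 n%:R ->
  exists u : 'rV[R]_n -> R,
    [/\ frac_laplacian_dom alpha u,
        forall x, 0 < u x,
        radially_symmetric u,
        forall x, cvg (frac_laplacian_trunc alpha u x e @[e --> 0^'+]) /\
                  0 <= frac_laplacian alpha u x &
        forall x y, enorm x < enorm y -> enorm y < 1 -> u x < u y].
Proof.
move=> n1 a0; rewrite lt_min => /andP[a2 an].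
have [e /andP[e0 e1] He] := prof_superharmonic_in n1 a0 a2 an.
have e01 : 0 <= e <= 1 by rewrite (ltW e0).
have [C HC] := prof_symdiff an e01.
pose w := @bubble R n alpha.
pose u x := @prof R n alpha e (w x).
have mu : measurable_fun setT u by exact: measurable_prof_bubble.
have uB x : `|u x| <= 3 by exact: prof_bubble_norm.
have E0 x : (0 <= \int[@lebesgue_rV R n]_y
    (symdiff u x y * riesz alpha (y - x))%:E)%E.
  have [x1|x1] := ltP (esq x) 1; first exact: He.
  exact: prof_superharmonic_out.
have cv x := cvg_frac_laplacian_trunc a0 a2 an mu uB (HC x).
exists u; split.
- split.
    have ta : (Num.truncn alpha)%:R <= alpha by rewrite truncn_le// ltW.
    (* The choice that makes the Hoelder exponent equal to 1; it is positive because the fractional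
       part of [alpha] is less than 1. *)
    exists (1 - (alpha - (Num.truncn alpha)%:R)); split.
    + have := truncnS_gt alpha; rewrite -natr1; lra.
    + by rewrite subrKC.
    + rewrite subrKC.
      have L0 : 0 <= 4 :> R by [].
      have k1 : (Num.truncn alpha <= 1)%N.
        by rewrite -ltnS -(ltr_nat R) (le_lt_trans ta).
      exact: (profile_hoelder an (is_derive_prof n alpha e) L0
        (fun s t => prof'_lip n alpha s t e01) k1).
  split => //.
  have w0 (x : 'rV[R]_n) : 0 <= 1 / (1 + enorm x `^ (n%:R + alpha)) :> R.
    by rewrite divr_ge0// addr_ge0// powR_ge0.
  (* [u] is bounded by 3, so a multiple of the weight dominates. *)
  apply: (@le_lt_trans _ _ (\int[@lebesgue_rV R n]_x
    (3%:E * (1 / (1 + enorm x `^ (n%:R + alpha)))%:E))%E).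
    apply: ge0_le_integral => //.
    + by move=> x _; rewrite lee_fin divr_ge0// addr_ge0// powR_ge0.
    + apply/measurable_EFinP; apply: measurable_funM; first exact: measurableT_comp.
      exact: measurable_weight.
    + apply: measurable_funeM; apply/measurable_EFinP; apply: measurable_funM => //.
      exact: measurable_weight.
    move=> x _; rewrite -EFinM lee_fin mul1r ler_wpM2r//.
    by have := w0 x; rewrite mul1r.
  rewrite ge0_integralZl_EFin//.
  + by rewrite lte_mul_pinfty// integral_weight_lty.
  + by move=> x _; rewrite lee_fin w0.
  + apply/measurable_EFinP; apply: measurable_funM => //.
    exact: measurable_weight.
- by move=> x; have /andP[h _] := prof_bubble_bounds an x e01; exact: lt_le_trans h.
- by move=> x y xy; rewrite /u /w /bubble -!enorm_sqr xy.
- move=> x; split; first by apply/cvg_ex; eexists; exact: cv.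
  rewrite /frac_laplacian (cvg_lim _ (cv x))//.
  rewrite mulr_ge0 ?frac_laplacian_cst_ge0 ?(ltW a0)// divr_ge0//.
  exact: fine_ge0.
- move=> x y xy y1.
  have ey : esq y < 1.
    by rewrite -enorm_sqr -[ltRHS](expr1n _ 2) ltr_sqr ?nnegrE ?enorm_ge0.
  have exy : esq x < esq y by rewrite -!enorm_sqr ltr_sqr ?nnegrE ?enorm_ge0.
  have wy : level n alpha < w y by rewrite level_lt_bubble.
  have wxy : w y < w x by rewrite bubble_lt.
  rewrite /u /prof !(@sqp_eq0 _ (level n alpha - _)) ?subr_le0 ?(ltW wy) ?(ltW (lt_trans wy wxy))//.
  rewrite ltrD2l ltrN2 ltr_pM2l// !sqp_sqr ?subr_ge0 ?(ltW wy) ?(ltW (lt_trans wy wxy))//.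
  by rewrite ltr_sqr ?nnegrE ?subr_ge0 ?(ltW wy) ?(ltW (lt_trans wy wxy))// ltrD2r.
Qed.
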